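(* Let $\mathcal{C},\mathcal{D},\mathcal{E}$ be fusion categories over a field $\Bbbk$, and let $F'':\mathcal{E}\to\mathcal{D}$, $F':\mathcal{D}\to\mathcal{C}$ and $F:\mathcal{E}\to\mathcal{C}$ be tensor functors with $F=F'F''$. Assume that $F$ is normal and $F''$ is dominant. Then: (1) The functor $F'$ is normal. (2) Denoting by $\mathbb{A}$ and $\mathbb{A}''$ the induced central algebras of $F$ and $F''$ respectively, which are commutative algebras in the categorical center $\mathcal{Z}(\mathcal{E})$ of $\mathcal{E}$, $\mathbb{A}''$ is a subalgebra of $\mathbb{A}$. (3) The functor $F''$ induces a dominant tensor functor $F''_0:\mathfrak{Ker}_F\to\mathfrak{Ker}_{F'}$, with $\mathfrak{Ker}_{F''_0}=\mathfrak{Ker}_{F''}$, and the following assertions are equivalent: (i) $F''$ is normal; (ii) $F''_0$ is normal; (iii) $\mathrm{FPdim}(\mathfrak{Ker}_{F''})=[\mathfrak{Ker}_F:\mathfrak{Ker}_{F'}]$.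
   Context: A fusion category over a field $\Bbbk$ is a $\Bbbk$-linear semisimple rigid monoidal category with finitely many isomorphism classes of simple objects, finite dimensional Hom spaces, such that $\mathrm{End}(S)=\Bbbk$ for every simple object $S$, and whose unit object $\mathbf{1}$ is simple. A fusion subcategory is a full replete monoidal subcategory which is itself a fusion category. $\Lambda_{\mathcal{C}}$ is the set of isomorphism classes of simple objects. ''Factor'' means direct summand. An object is trivial if isomorphic to $\mathbf{1}^n$ for some $n\in\mathbb{N}$. A tensor functor is a strong monoidal $\Bbbk$-linear functor. Let $G:\mathcal{X}\to\mathcal{Y}$ be a tensor functor between fusion categories. Its kernel $\mathfrak{Ker}_G\subset\mathcal{X}$ is the fusion subcategory of all objects $X$ such that $G(X)$ is trivial. $G$ is dominant if every $Y\in\Lambda_{\mathcal{Y}}$ is a factor of $G(X)$ for some $X\in\Lambda_{\mathcal{X}}$. $G$ is normal if for every $X\in\Lambda_{\mathcal{X}}$ such that $G(X)$ contains $\mathbf{1}$ as a factor, $G(X)$ is trivial. Induced central algebra of $G$: let $R$ be the right adjoint of $G$ (it exists, and carries the lax monoidal structure induced by that of $G$), and let $A=R(\mathbf{1})$, which is an algebra in $\mathcal{X}$. The unit $\eta$ of the adjunction and the lax monoidal structure of $R$ give natural isomorphisms $X\otimes R(Y)\to R(GX\otimes Y)$ and $R(Y)\otimes X\to R(Y\otimes GX)$ (e.g. the first is $\eta_X\otimes\mathrm{id}$ followed by $RGX\otimes RY\to R(GX\otimes Y)$). Taking $Y=\mathbf{1}$ one gets isomorphisms $A\otimes X\to RG(X)\leftarrow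 X\otimes A$, hence a natural isomorphism $\sigma_X:A\otimes X\to X\otimes A$. It is a half-braiding, and $\mathbb{A}=(A,\sigma)$ is a commutative algebra in the categorical (Drinfeld) center $\mathcal{Z}(\mathcal{X})$, called the induced central algebra of $G$. For simple $X$, $\mathrm{FPdim}(X)$ is the Frobenius-Perron eigenvalue of left multiplication by $[X]$ on the Grothendieck ring; $\mathrm{FPdim}(\mathcal{X})=\sum_{X\in\Lambda_{\mathcal{X}}}\mathrm{FPdim}(X)^2$; and $[\mathcal{X}:\mathcal{Y}]=\mathrm{FPdim}(\mathcal{X})/\mathrm{FPdim}(\mathcal{Y})$ for fusion categories $\mathcal{X},\mathcal{Y}$. *)

(* Defs.v *)
From HB Require Import structures.
From mathcomp Require Import all_boot all_order all_algebra.
From mathcomp Require Import boolp classical_sets reals.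

Set Implicit Arguments.
Unset Strict Implicit.
Unset Printing Implicit Defensive.

Import Order.TTheory GRing.Theory Num.Theory.
Local Open Scope ring_scope.

Declare Scope cat_scope.
Delimit Scope cat_scope with cat.
Local Open Scope cat_scope.

Reserved Notation "X ⟶ Y" (at level 60, no associativity).
Reserved Notation "g ∘ f" (at level 40, left associativity).
Reserved Notation "X ⊗ Y" (at level 39, left associativity).
Reserved Notation "f ⊠ g" (at level 39, left associativity).
Reserved Notation "X ≅ Y" (at level 70, no associativity).
Reserved Notation "𝟙" (at level 0).

Record lincat (k : fieldType) := LinCat {
  ob :> Type;
  hom : ob -> ob -> vectType k;
  idm : forall X, hom X X;
  mcomp : forall X Y Z, hom Y Z -> hom X Y -> hom X Z;
  comp1m : forall X Y (f : hom X Y), mcomp (idm Y) f = f;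
  compm1 : forall X Y (f : hom X Y), mcomp f (idm X) = f;
  compA : forall X Y Z W (h : hom Z W) (g : hom Y Z) (f : hom X Y),
    mcomp h (mcomp g f) = mcomp (mcomp h g) f;
  comp_linr : forall X Y Z (g : hom Y Z), linear (@mcomp X Y Z g);
  comp_linl : forall X Y Z (f : hom X Y),
    linear (fun g : hom Y Z => mcomp g f)
}.

Arguments idm {k l} X.
Arguments mcomp {k l X Y Z} g f.

Notation "X ⟶ Y" := (hom X Y) : cat_scope.
Notation "g ∘ f" := (mcomp g f) : cat_scope.

Section LinCat.
Variables (k : fieldType) (C : lincat k).
Implicit Types X Y Z : C.

Definition is_iso X Y (f : X ⟶ Y) : Prop :=
  exists g : Y ⟶ X, g ∘ f = idm X /\ f ∘ g = idm Y.

Definition isomorphic X Y : Prop := exists f : X ⟶ Y, is_iso f.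

Definition mono X Y (f : X ⟶ Y) : Prop :=
  forall Z (g h : Z ⟶ X), f ∘ g = f ∘ h -> g = h.

Definition epi X Y (f : X ⟶ Y) : Prop :=
  forall Z (g h : Y ⟶ Z), g ∘ f = h ∘ f -> g = h.

Definition is_kernel K X Y (f : X ⟶ Y) (i : K ⟶ X) : Prop :=
  f ∘ i = 0 /\
  forall Z (g : Z ⟶ X), f ∘ g = 0 -> exists! h : Z ⟶ K, i ∘ h = g.

Definition is_cokernel X Y Q (f : X ⟶ Y) (p : Y ⟶ Q) : Prop :=
  p ∘ f = 0 /\
  forall Z (g : Y ⟶ Z), g ∘ f = 0 -> exists! h : Q ⟶ Z, h ∘ p = g.

(* [X] is the biproduct of the finite family [Y]; for an empty index type this
   says that [X] is a zero object. *)
Definition is_dirsum (I : finType) (Y : I -> C) X : Prop :=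
  exists (i : forall j, Y j ⟶ X) (p : forall j, X ⟶ Y j),
    [/\ forall j, p j ∘ i j = idm (Y j),
        forall j l, j != l -> p l ∘ i j = 0 &
        \sum_j (i j ∘ p j) = idm X].

Record abelian : Prop := Abelian {
  ab_dirsum : forall n (Y : 'I_n -> C), exists X, is_dirsum Y X;
  ab_kernel : forall X Y (f : X ⟶ Y), exists K (i : K ⟶ X), is_kernel f i;
  ab_cokernel : forall X Y (f : X ⟶ Y), exists Q (p : Y ⟶ Q), is_cokernel f p;
  ab_mono : forall X Y (f : X ⟶ Y), mono f ->
    exists Z (g : Y ⟶ Z), is_kernel g f;
  ab_epi : forall X Y (f : X ⟶ Y), epi f ->
    exists Z (g : Z ⟶ X), is_cokernel g f
}.

Definition simple X : Prop :=
  idm X <> 0 /\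
  forall Y (f : Y ⟶ X), mono f -> idm Y = 0 \/ is_iso f.

Definition factor Y X : Prop :=
  exists Z, is_dirsum (fun b : bool => if b then Y else Z) X.

Definition semisimple : Prop :=
  abelian /\
  forall X, exists n (S : 'I_n -> C), (forall i, simple (S i)) /\ is_dirsum S X.

(* [S] enumerates without repetition the isomorphism classes of simple
   objects. *)
Definition is_irr (I : finType) (S : I -> C) : Prop :=
  [/\ forall i, simple (S i),
      forall i j, isomorphic (S i) (S j) -> i = j &
      forall X, simple X -> exists i, isomorphic X (S i)].

End LinCat.

Notation "X ≅ Y" := (isomorphic X Y) : cat_scope.

Record moncat (k : fieldType) := MonCat {
  mcat :> lincat k;
  tob : mcat -> mcat -> mcat;
  tmor : forall X X' Y Y' : mcat,
    (X ⟶ X') -> (Y ⟶ Y') -> (tob X Y ⟶ tob X' Y');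
  tun : mcat;
  as_ : forall X Y Z, tob (tob X Y) Z ⟶ tob X (tob Y Z);
  asI : forall X Y Z, tob X (tob Y Z) ⟶ tob (tob X Y) Z;
  lu : forall X, tob tun X ⟶ X;
  luI : forall X, X ⟶ tob tun X;
  ru : forall X, tob X tun ⟶ X;
  ruI : forall X, X ⟶ tob X tun;
  tmor1 : forall X Y, tmor (idm X) (idm Y) = idm (tob X Y);
  tmorM : forall X X' X'' Y Y' Y'' (f' : X' ⟶ X'') (f : X ⟶ X')
      (g' : Y' ⟶ Y'') (g : Y ⟶ Y'),
    tmor (f' ∘ f) (g' ∘ g) = tmor f' g' ∘ tmor f g;
  tmor_linr : forall X X' Y Y' (f : X ⟶ X'), linear (@tmor X X' Y Y' f);
  tmor_linl : forall X X' Y Y' (g : Y ⟶ Y'),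
    linear (fun f : X ⟶ X' => tmor f g);
  asK : forall X Y Z, asI X Y Z ∘ as_ X Y Z = idm _;
  asIK : forall X Y Z, as_ X Y Z ∘ asI X Y Z = idm _;
  luK : forall X, luI X ∘ lu X = idm _;
  luIK : forall X, lu X ∘ luI X = idm _;
  ruK : forall X, ruI X ∘ ru X = idm _;
  ruIK : forall X, ru X ∘ ruI X = idm _;
  as_nat : forall X X' Y Y' Z Z' (f : X ⟶ X') (g : Y ⟶ Y') (h : Z ⟶ Z'),
    as_ X' Y' Z' ∘ tmor (tmor f g) h = tmor f (tmor g h) ∘ as_ X Y Z;
  lu_nat : forall X X' (f : X ⟶ X'), lu X' ∘ tmor (idm tun) f = f ∘ lu X;
  ru_nat : forall X X' (f : X ⟶ X'), ru X' ∘ tmor f (idm tun) = f ∘ ru X;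
  pentagon : forall X Y Z W,
    as_ X Y (tob Z W) ∘ as_ (tob X Y) Z W =
    tmor (idm X) (as_ Y Z W) ∘ as_ X (tob Y Z) W ∘ tmor (as_ X Y Z) (idm W);
  triangle : forall X Y,
    tmor (idm X) (lu Y) ∘ as_ X tun Y = tmor (ru X) (idm Y)
}.

Arguments tob {k m} X Y.
Arguments tmor {k m X X' Y Y'} f g.
Arguments tun {k m}.
Arguments as_ {k m} X Y Z.
Arguments asI {k m} X Y Z.
Arguments lu {k m} X.
Arguments luI {k m} X.
Arguments ru {k m} X.
Arguments ruI {k m} X.

Notation "X ⊗ Y" := (tob X Y) : cat_scope.
Notation "f ⊠ g" := (tmor f g) : cat_scope.
Notation "𝟙" := tun : cat_scope.

Section MonCat.
Variables (k : fieldType) (C : moncat k).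
Implicit Types X Y : C.

Definition zigzag X Xs (ev : Xs ⊗ X ⟶ 𝟙) (coev : 𝟙 ⟶ X ⊗ Xs) : Prop :=
  ru X ∘ (idm X ⊠ ev) ∘ as_ X Xs X ∘ (coev ⊠ idm X) ∘ luI X = idm X.

Definition zagzig X Xs (ev : Xs ⊗ X ⟶ 𝟙) (coev : 𝟙 ⟶ X ⊗ Xs) : Prop :=
  lu Xs ∘ (ev ⊠ idm Xs) ∘ asI Xs X Xs ∘ (idm Xs ⊠ coev) ∘ ruI Xs = idm Xs.

(* [Xs] is a left dual of [X]; equivalently, [X] is a right dual of [Xs]. *)
Definition is_dual Xs X : Prop :=
  exists (ev : Xs ⊗ X ⟶ 𝟙) (coev : 𝟙 ⟶ X ⊗ Xs), zigzag ev coev /\ zagzig ev coev.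

Definition rigid : Prop :=
  forall X, (exists Xs, is_dual Xs X) /\ (exists sX, is_dual X sX).

(* [X] is isomorphic to 𝟙^n for some n. *)
Definition trivial X : Prop :=
  exists n : nat, is_dirsum (fun _ : 'I_n => 𝟙) X.

Record is_fusion : Prop := IsFusion {
  fus_semisimple : semisimple C;
  fus_rigid : rigid;
  fus_finite : exists (I : finType) (S : I -> C), is_irr S;
  fus_split : forall S : C, simple S ->
    forall f : S ⟶ S, exists a : k, f = a *: idm S;
  fus_unit : simple (𝟙 : C)
}.

End MonCat.

Record fusioncat (k : fieldType) := FusionCat {
  fcat :> moncat k;
  fusP : is_fusion fcat
}.

Record tfunctor (k : fieldType) (C D : moncat k) := TFunctor {
  fob :> C -> D;
  fmor : forall X Y : C, (X ⟶ Y) -> (fob X ⟶ fob Y);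
  fmor1 : forall X, fmor (idm X) = idm (fob X);
  fmorM : forall X Y Z (g : Y ⟶ Z) (f : X ⟶ Y), fmor (g ∘ f) = fmor g ∘ fmor f;
  fmor_lin : forall X Y, linear (@fmor X Y);
  mu : forall X Y, fob X ⊗ fob Y ⟶ fob (X ⊗ Y);
  muI : forall X Y, fob (X ⊗ Y) ⟶ fob X ⊗ fob Y;
  eps : 𝟙 ⟶ fob 𝟙;
  epsI : fob 𝟙 ⟶ 𝟙;
  muK : forall X Y, muI X Y ∘ mu X Y = idm _;
  muIK : forall X Y, mu X Y ∘ muI X Y = idm _;
  epsK : epsI ∘ eps = idm _;
  epsIK : eps ∘ epsI = idm _;
  mu_nat : forall X X' Y Y' (f : X ⟶ X') (g : Y ⟶ Y'),
    mu X' Y' ∘ (fmor f ⊠ fmor g) = fmor (f ⊠ g) ∘ mu X Y;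
  mu_as : forall X Y Z,
    fmor (as_ X Y Z) ∘ mu (X ⊗ Y) Z ∘ (mu X Y ⊠ idm (fob Z)) =
    mu X (Y ⊗ Z) ∘ (idm (fob X) ⊠ mu Y Z) ∘ as_ (fob X) (fob Y) (fob Z);
  mu_lu : forall X, fmor (lu X) ∘ mu 𝟙 X ∘ (eps ⊠ idm (fob X)) = lu (fob X);
  mu_ru : forall X, fmor (ru X) ∘ mu X 𝟙 ∘ (idm (fob X) ⊠ eps) = ru (fob X)
}.

Arguments fmor {k C D} t {X Y} f.
Arguments mu {k C D} t X Y.
Arguments muI {k C D} t X Y.
Arguments eps {k C D} t.
Arguments epsI {k C D} t.

Section LinFacts.
Variables (k : fieldType) (C : lincat k).
Implicit Types X Y Z : C.

HB.instance Definition _ X Y Z (g : Y ⟶ Z) :=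
  GRing.isLinear.Build k (X ⟶ Y) (X ⟶ Z) *:%R (@mcomp k C X Y Z g)
    (@comp_linr k C X Y Z g).

Definition rcomp X Y Z (f : X ⟶ Y) (g : Y ⟶ Z) : X ⟶ Z := g ∘ f.

HB.instance Definition _ X Y Z (f : X ⟶ Y) :=
  GRing.isLinear.Build k (Y ⟶ Z) (X ⟶ Z) *:%R (@rcomp X Y Z f)
    (@comp_linl k C X Y Z f).

Lemma comp0m X Y Z (f : X ⟶ Y) : (0 : Y ⟶ Z) ∘ f = 0.
Proof. exact: (linear0 (rcomp f)). Qed.

Lemma compm0 X Y Z (g : Y ⟶ Z) : g ∘ (0 : X ⟶ Y) = 0.
Proof. exact: linear0. Qed.

Lemma compBl X Y Z (g h : Y ⟶ Z) (f : X ⟶ Y) : (g - h) ∘ f = g ∘ f - h ∘ f.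
Proof. exact: (linearB (rcomp f)). Qed.

Lemma compBr X Y Z (h : Y ⟶ Z) (f g : X ⟶ Y) : h ∘ (f - g) = h ∘ f - h ∘ g.
Proof. exact: linearB. Qed.

Lemma compZl X Y Z a (g : Y ⟶ Z) (f : X ⟶ Y) : (a *: g) ∘ f = a *: (g ∘ f).
Proof. exact: (linearZ_LR (rcomp f)). Qed.

Lemma compZr X Y Z a (g : Y ⟶ Z) (f : X ⟶ Y) : g ∘ (a *: f) = a *: (g ∘ f).
Proof. exact: linearZ_LR. Qed.

Lemma comp_suml X Y Z (I : finType) (g : I -> (Y ⟶ Z)) (f : X ⟶ Y) :
  (\sum_i g i) ∘ f = \sum_i (g i ∘ f).
Proof. exact: (linear_sum (rcomp f)). Qed.

Lemma comp_sumr X Y Z (I : finType) (g : Y ⟶ Z) (f : I -> (X ⟶ Y)) :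
  g ∘ (\sum_i f i) = \sum_i (g ∘ f i).
Proof. exact: linear_sum. Qed.

Lemma isomorphic_refl X : X ≅ X.
Proof. by exists (idm X), (idm X); rewrite comp1m. Qed.

Lemma isomorphic_sym X Y : X ≅ Y -> Y ≅ X.
Proof. by case=> f [g [gf fg]]; exists g, f. Qed.

Lemma isomorphic_trans X Y Z : X ≅ Y -> Y ≅ Z -> X ≅ Z.
Proof.
case=> f [g [gf fg]] [f' [g' [gf' fg']]]; exists (f' ∘ f), (g ∘ g'); split.
  by rewrite -compA (compA g') gf' comp1m.
by rewrite -compA (compA f) fg comp1m.
Qed.

Lemma dirsum_isoX (I : finType) (Y : I -> C) X X' :
  X ≅ X' -> is_dirsum Y X -> is_dirsum Y X'.
Proof.
case=> f [g [gf fg]] [i [p [H1 H2 H3]]].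
exists (fun j => f ∘ i j), (fun j => p j ∘ g); split.
- by move=> j; rewrite -compA (compA g) gf comp1m.
- by move=> j l ne; rewrite -compA (compA g) gf comp1m H2.
- under eq_bigr => j _ do rewrite -compA (compA (i j)).
  by rewrite -comp_sumr -comp_suml H3 comp1m.
Qed.

Lemma dirsum_isoY (I : finType) (Y Y' : I -> C) X :
  (forall j, Y j ≅ Y' j) -> is_dirsum Y X -> is_dirsum Y' X.
Proof.
move=> /(_ _)/cid Hiso [i [p [H1 H2 H3]]].
pose f j := sval (Hiso j).
have Hg j : {g : Y' j ⟶ Y j | g ∘ f j = idm _ /\ f j ∘ g = idm _}.
  exact/cid/(svalP (Hiso j)).
pose g j := sval (Hg j).
have gf j : g j ∘ f j = idm _ by exact: (svalP (Hg j)).1.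
have fg j : f j ∘ g j = idm _ by exact: (svalP (Hg j)).2.
exists (fun j => i j ∘ g j), (fun j => f j ∘ p j); split.
- by move=> j; rewrite -compA (compA (p j)) H1 comp1m.
- by move=> j l ne; rewrite -compA (compA (p l)) H2 // comp0m compm0.
- by under eq_bigr => j _ do rewrite -compA (compA (g j)) gf comp1m.
Qed.

Lemma dirsum_reindex (I J : finType) (h : J -> I) (Y : I -> C) X :
  bijective h -> is_dirsum Y X -> is_dirsum (fun j => Y (h j)) X.
Proof.
move=> bh [i [p [H1 H2 H3]]].
exists (fun j => i (h j)), (fun j => p (h j)); split=> //.
- by move=> j l ne; apply: H2; rewrite (inj_eq (bij_inj bh)).
- by rewrite -H3 (reindex h) //; exact: onW_bij.
Qed.

Lemma dirsum_nested (I : finType) (J : I -> finType) (Z : forall i, J i -> C)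
    (Y : I -> C) X :
  is_dirsum Y X -> (forall i, is_dirsum (Z i) (Y i)) ->
  is_dirsum (fun u : {i : I & J i} => Z (tag u) (tagged u)) X.
Proof.
move=> [i [p [H1 H2 H3]]] /(_ _)/cid HZ.
pose a j := sval (HZ j).
have Hb j := cid (svalP (HZ j)).
pose b j := sval (Hb j).
have K j := svalP (Hb j).
exists (fun u => i (tag u) ∘ a (tag u) (tagged u)).
exists (fun u => b (tag u) (tagged u) ∘ p (tag u)); split.
- by move=> [j l] /=; rewrite -compA (compA (p j)) H1 comp1m; case: (K j).
- move=> [j l] [j' l'] ne /=; rewrite -compA (compA (p j')).
  have [E|nj] := eqVneq j j'; last by rewrite H2 // comp0m compm0.
  subst j'; rewrite H1 comp1m; case: (K j) => _ Kj _; apply: Kj.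
  by apply: contraNneq ne => ->.
- transitivity (\sum_j \sum_l (i j ∘ a j l ∘ (b j l ∘ p j))).
    by rewrite sig_big_dep.
  rewrite -H3; apply: eq_bigr => j _.
  under eq_bigr => l _ do rewrite -compA (compA (a j l)).
  by rewrite -comp_sumr -comp_suml; case: (K j) => _ _ ->; rewrite comp1m.
Qed.

Lemma mono0P X Y (f : X ⟶ Y) :
  (forall Z (g : Z ⟶ X), f ∘ g = 0 -> g = 0) -> mono f.
Proof.
move=> H Z g h /eqP; rewrite -subr_eq0 -compBr => /eqP/H/eqP.
by rewrite subr_eq0 => /eqP.
Qed.

Lemma epi0P X Y (f : X ⟶ Y) :
  (forall Z (g : Y ⟶ Z), g ∘ f = 0 -> g = 0) -> epi f.
Proof.
move=> H Z g h /eqP; rewrite -subr_eq0 -compBl => /eqP/H/eqP.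
by rewrite subr_eq0 => /eqP.
Qed.

Lemma kernel_mono K X Y (f : X ⟶ Y) (i : K ⟶ X) : is_kernel f i -> mono i.
Proof.
move=> [fi H] Z g h e.
have [|u [_ Hu]] := H Z (i ∘ g); first by rewrite compA fi comp0m.
by rewrite -(Hu g) // -(Hu h).
Qed.

Lemma cokernel_epi X Y Q (f : X ⟶ Y) (p : Y ⟶ Q) : is_cokernel f p -> epi p.
Proof.
move=> [pf H] Z g h e.
have [|u [_ Hu]] := H Z (g ∘ p); first by rewrite -compA pf compm0.
by rewrite -(Hu g) // -(Hu h).
Qed.

Lemma split_mono_mono X Y (f : X ⟶ Y) r : r ∘ f = idm X -> mono f.
Proof. by move=> rf Z g h e; rewrite -(comp1m g) -rf -compA e compA rf comp1m. Qed.

Lemma split_epi_epi X Y (f : X ⟶ Y) r : f ∘ r = idm Y -> epi f.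
Proof. by move=> rf Z g h e; rewrite -(compm1 g) -rf compA e -compA rf compm1. Qed.

Lemma split_mono_kernel X Y (f : X ⟶ Y) r :
  r ∘ f = idm X -> is_kernel (idm Y - f ∘ r) f.
Proof.
move=> rf; split; first by rewrite compBl comp1m -compA rf compm1 subrr.
move=> Z g /eqP; rewrite compBl comp1m subr_eq0 => /eqP e.
exists (r ∘ g); split; first by rewrite compA -e.
by move=> h <-; rewrite compA rf comp1m.
Qed.

Lemma split_epi_cokernel X Y (f : X ⟶ Y) r :
  f ∘ r = idm Y -> is_cokernel (idm X - r ∘ f) f.
Proof.
move=> fr; split; first by rewrite compBr compm1 compA fr comp1m subrr.
move=> Z g /eqP; rewrite compBr compm1 subr_eq0 => /eqP e.
exists (g ∘ r); split; first by rewrite -compA -e.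
by move=> h <-; rewrite -compA fr compm1.
Qed.

Lemma dirsum_in_neq0 (I : finType) (Y : I -> C) X T (g : T ⟶ X)
    (i : forall j, Y j ⟶ X) (p : forall j, X ⟶ Y j) :
  \sum_j (i j ∘ p j) = idm X -> g <> 0 -> exists j, p j ∘ g <> 0.
Proof.
move=> H gn0; apply: contrapT => /forallNP K; apply: gn0.
rewrite -(comp1m g) -H comp_suml big1 // => j _.
by rewrite -compA (contrapT (K j)) compm0.
Qed.

Lemma dirsum_out_neq0 (I : finType) (Y : I -> C) X T (g : X ⟶ T)
    (i : forall j, Y j ⟶ X) (p : forall j, X ⟶ Y j) :
  \sum_j (i j ∘ p j) = idm X -> g <> 0 -> exists j, g ∘ i j <> 0.
Proof.
move=> H gn0; apply: contrapT => /forallNP K; apply: gn0.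
rewrite -(compm1 g) -H comp_sumr big1 // => j _.
by rewrite compA (contrapT (K j)) comp0m.
Qed.

Hypothesis abC : abelian C.

Lemma schur X Y (f : X ⟶ Y) : simple X -> simple Y -> f <> 0 -> is_iso f.
Proof.
move=> [X0 sX] [Y0 sY] fn0; have [K [i [fi Hi]]] := ab_kernel abC f.
have mi : mono i by exact: (@kernel_mono _ _ _ f).
have mf : mono f.
  apply: mono0P => Z g /Hi [h [<- _]].
  case: (sX _ i mi) => [K0|[j [_ ij]]]; first by rewrite -(comp1m h) K0 comp0m compm0.
  by case: fn0; rewrite -(compm1 f) -ij compA fi comp0m.
by case: (sY _ f mf) => // X00; case: X0.
Qed.

Lemma retract_factor X Y (f : Y ⟶ X) (r : X ⟶ Y) : r ∘ f = idm Y -> factor Y X.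
Proof.
move=> rf; have [K [i [ri Hi]]] := ab_kernel abC r.
have mi : mono i by exact: (@kernel_mono _ _ _ r).
have [|h [ih _]] := Hi _ (idm X - f ∘ r).
  by rewrite compBr compm1 compA rf comp1m subrr.
exists K.
pose ii b := if b as b0 return (if b0 then Y else K) ⟶ X then f else i.
pose pp b := if b as b0 return X ⟶ (if b0 then Y else K) then r else h.
exists ii, pp; split.
- case=> //=; apply: mi; rewrite compA ih compBl comp1m compm1 -compA ri.
  by rewrite compm0 subr0.
- case=> [] [] // _ /=; apply: mi.
  by rewrite compA ih compBl comp1m -compA rf compm1 subrr compm0.
- by rewrite big_bool /= ih addrC subrK.
Qed.

End LinFacts.

Section SemisimpleFacts.
Variables (k : fieldType) (C : lincat k).
Implicit Types X Y Z : C.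
Hypothesis ssC : semisimple C.
Hypothesis spC : forall S : C, simple S ->
  forall f : S ⟶ S, exists a : k, f = a *: idm S.
Variables (I : finType) (S : I -> C).
Hypothesis irrS : is_irr S.

Lemma irr_decomp X : exists n (c : 'I_n -> I), is_dirsum (fun j => S (c j)) X.
Proof.
case: ssC => _ /(_ X)[n [T [sT dT]]]; case: irrS => _ _ H.
have {}H j := cid (H _ (sT j)).
exists n, (fun j => sval (H j)).
by apply: dirsum_isoY dT => j; exact: (svalP (H j)).
Qed.

Lemma irr_hom i j (f : S i ⟶ S j) : i <> j -> f = 0.
Proof.
move=> ne; apply: contrapT => fn0; case: irrS => sS inj _; apply: ne.
by apply: inj; exists f; apply: schur => //; case: ssC.
Qed.

Lemma mono_split X Y (f : X ⟶ Y) : mono f -> exists r, r ∘ f = idm X.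
Proof.
move=> mf; case: irrS => sS inj _.
have [m [c [i [p [H1 H2 H3]]]]] := irr_decomp X.
have [n [d [j [q [K1 K2 K3]]]]] := irr_decomp Y.
pose L a := linfun (@mcomp k C (S a) X Y f).
have LK a : cancel (L a) (L a)^-1%VF.
  by apply/lker0_lfunK/lker0P => g h; rewrite !lfunE /=; exact: mf.
exists (\sum_b ((L (d b))^-1%VF (j b) ∘ q b)).
suff E a (g : S a ⟶ X) : (\sum_b ((L (d b))^-1%VF (j b) ∘ q b)) ∘ f ∘ g = g.
  by rewrite -[LHS]compm1 -H3 comp_sumr; apply: eq_bigr => l _; rewrite compA E.
have Eg : L a g = \sum_b (j b ∘ (q b ∘ (f ∘ g))).
  rewrite lfunE /= -[LHS]comp1m -K3 comp_suml.
  by apply: eq_bigr => b _; rewrite -compA.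
rewrite !comp_suml -[RHS](LK a) Eg linear_sum.
apply: eq_bigr => b _; rewrite -!compA.
have [E|ne] := pselect (a = d b); last first.
  by rewrite (irr_hom (q b ∘ (f ∘ g)) ne) !compm0 linear0.
move: (q b) (j b); rewrite -E => qb jb.
have [t ->] := spC (sS a) (qb ∘ (f ∘ g)).
by rewrite !compZr !compm1 linearZ.
Qed.

Lemma epi_split X Y (f : X ⟶ Y) : epi f -> exists r, f ∘ r = idm Y.
Proof.
move=> mf; case: irrS => sS inj _.
have [m [c [i [p [H1 H2 H3]]]]] := irr_decomp Y.
have [n [d [j [q [K1 K2 K3]]]]] := irr_decomp X.
pose L a := linfun (@rcomp k C X Y (S a) f).
have LK a : cancel (L a) (L a)^-1%VF.
  by apply/lker0_lfunK/lker0P => g h; rewrite !lfunE /=; exact: mf.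
exists (\sum_b (j b ∘ (L (d b))^-1%VF (q b))).
suff E a (g : Y ⟶ S a) : g ∘ (f ∘ \sum_b (j b ∘ (L (d b))^-1%VF (q b))) = g.
  by rewrite -[LHS]comp1m -H3 comp_suml; apply: eq_bigr => l _; rewrite -compA E.
have Eg : L a g = \sum_b (g ∘ f ∘ j b ∘ q b).
  rewrite lfunE /= /rcomp -[LHS]compm1 -K3 comp_sumr.
  by apply: eq_bigr => b _; rewrite compA.
rewrite !comp_sumr -[RHS](LK a) Eg linear_sum.
apply: eq_bigr => b _; rewrite !compA.
have [E|ne] := pselect (d b = a); last first.
  by rewrite (irr_hom (g ∘ f ∘ j b) ne) !comp0m linear0.
move: (q b) (j b); rewrite E => qb jb.
have [t ->] := spC (sS a) (g ∘ f ∘ jb).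
by rewrite !compZl !comp1m linearZ.
Qed.

End SemisimpleFacts.

Section MonFacts.
Variables (k : fieldType) (C : moncat k).
Implicit Types X Y Z : C.

HB.instance Definition _ X X' Y Y' (f : X ⟶ X') :=
  GRing.isLinear.Build k (Y ⟶ Y') (X ⊗ Y ⟶ X' ⊗ Y') *:%R
    (@tmor k C X X' Y Y' f) (@tmor_linr k C X X' Y Y' f).

Definition rtmor X X' Y Y' (g : Y ⟶ Y') (f : X ⟶ X') : X ⊗ Y ⟶ X' ⊗ Y' := f ⊠ g.

HB.instance Definition _ X X' Y Y' (g : Y ⟶ Y') :=
  GRing.isLinear.Build k (X ⟶ X') (X ⊗ Y ⟶ X' ⊗ Y') *:%R
    (@rtmor X X' Y Y' g) (@tmor_linl k C X X' Y Y' g).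

Lemma tmor0l X X' Y Y' (g : Y ⟶ Y') : (0 : X ⟶ X') ⊠ g = 0.
Proof. exact: (linear0 (rtmor g)). Qed.

Lemma tmor0r X X' Y Y' (f : X ⟶ X') : f ⊠ (0 : Y ⟶ Y') = 0.
Proof. exact: linear0. Qed.

Lemma tmor_suml X X' Y Y' (I : finType) (f : I -> (X ⟶ X')) (g : Y ⟶ Y') :
  (\sum_i f i) ⊠ g = \sum_i (f i ⊠ g).
Proof. exact: (linear_sum (rtmor g)). Qed.

Lemma tmor_sumr X X' Y Y' (I : finType) (f : X ⟶ X') (g : I -> (Y ⟶ Y')) :
  f ⊠ (\sum_i g i) = \sum_i (f ⊠ g i).
Proof. exact: linear_sum. Qed.

Lemma tmorMl X X' X'' Y (g : X' ⟶ X'') (f : X ⟶ X') :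
  (g ∘ f) ⊠ idm Y = (g ⊠ idm Y) ∘ (f ⊠ idm Y).
Proof. by rewrite -tmorM comp1m. Qed.

Lemma tmorMr X Y Y' Y'' (g : Y' ⟶ Y'') (f : Y ⟶ Y') :
  idm X ⊠ (g ∘ f) = (idm X ⊠ g) ∘ (idm X ⊠ f).
Proof. by rewrite -tmorM comp1m. Qed.

Lemma tmor_swap X X' Y Y' (f : X ⟶ X') (g : Y ⟶ Y') :
  (f ⊠ idm Y') ∘ (idm X ⊠ g) = (idm X' ⊠ g) ∘ (f ⊠ idm Y).
Proof. by rewrite -!tmorM !comp1m !compm1. Qed.

Lemma ruI_nat X X' (f : X ⟶ X') : (f ⊠ idm 𝟙) ∘ ruI X = ruI X' ∘ f.
Proof.
by rewrite -[LHS]comp1m -(ruK X') -compA (compA (ru X')) ru_nat -compA ruIK compm1.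
Qed.

Lemma luI_nat X X' (f : X ⟶ X') : (idm 𝟙 ⊠ f) ∘ luI X = luI X' ∘ f.
Proof.
by rewrite -[LHS]comp1m -(luK X') -compA (compA (lu X')) lu_nat -compA luIK compm1.
Qed.

Lemma asI_nat X X' Y Y' Z Z' (f : X ⟶ X') (g : Y ⟶ Y') (h : Z ⟶ Z') :
  asI X' Y' Z' ∘ (f ⊠ (g ⊠ h)) = ((f ⊠ g) ⊠ h) ∘ asI X Y Z.
Proof.
rewrite -[RHS]comp1m -(asK X' Y' Z') -compA (compA (as_ X' Y' Z')) as_nat.
by rewrite -compA asIK compm1.
Qed.

Lemma dirsum_tensor (I J : finType) (Y : I -> C) (Z : J -> C) X X' :
  is_dirsum Y X -> is_dirsum Z X' ->
  is_dirsum (fun u : I * J => Y u.1 ⊗ Z u.2) (X ⊗ X').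
Proof.
move=> [i [p [H1 H2 H3]]] [i' [p' [H1' H2' H3']]].
exists (fun u => i u.1 ⊠ i' u.2), (fun u => p u.1 ⊠ p' u.2); split.
- by move=> [a b] /=; rewrite -tmorM H1 H1' tmor1.
- move=> [a b] [a' b'] ne; rewrite -tmorM /=.
  have [E|na] := eqVneq a a'; last by rewrite H2 // tmor0l.
  by rewrite (H2' b) ?tmor0r //; apply: contraNneq ne => ->; rewrite E.
- rewrite -tmor1 -H3 -H3' tmor_suml.
  rewrite -(pair_bigA _ (fun a b => (i a ⊠ i' b) ∘ (p a ⊠ p' b))) /=.
  apply: eq_bigr => a _; rewrite tmor_sumr.
  by apply: eq_bigr => b _; rewrite -tmorM.
Qed.

Lemma trivialP X : trivial X <->
  exists (I : finType) (Y : I -> C), (forall i, Y i ≅ 𝟙) /\ is_dirsum Y X.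
Proof.
split=> [[n H]|[I [Y [HY H]]]].
  by exists 'I_n, (fun=> 𝟙); split=> // _; exact: isomorphic_refl.
exists #|I|; apply: (dirsum_isoY (Y := fun j : 'I_#|I| => Y (enum_val j))).
  by move=> j; exact: HY.
exact: dirsum_reindex (enum_val_bij I) H.
Qed.

Lemma trivial_iso X Y : X ≅ Y -> trivial X -> trivial Y.
Proof. by move=> e [n H]; exists n; exact: dirsum_isoX H. Qed.

Lemma trivial_unit : trivial (𝟙 : C).
Proof.
exists 1%N, (fun=> idm 𝟙), (fun=> idm 𝟙); split.
- by move=> _; rewrite comp1m.
- by move=> j l; rewrite (ord1 j) (ord1 l) eqxx.
- by rewrite big_ord1 comp1m.
Qed.

Lemma trivial_tensor X Y : trivial X -> trivial Y -> trivial (X ⊗ Y).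
Proof.
move=> [n HX] [m HY]; apply/trivialP.
exists ('I_n * 'I_m)%type, (fun=> 𝟙 ⊗ 𝟙); split; last exact: dirsum_tensor HX HY.
by move=> _; exists (lu 𝟙), (luI 𝟙); rewrite luK luIK.
Qed.

Lemma trivial_dirsum (I : finType) (Y : I -> C) X :
  (forall i, trivial (Y i)) -> is_dirsum Y X -> trivial X.
Proof.
move=> /(_ _)/cid H HX; apply/trivialP.
exists {i : I & 'I_(sval (H i))}, (fun=> 𝟙); split.
  by move=> _; exact: isomorphic_refl.
exact: (dirsum_nested (J := fun i => 'I_(sval (H i))) HX (fun i => svalP (H i))).
Qed.

Hypotheses (ssC : semisimple C) (s1 : simple (𝟙 : C)).

Lemma trivial_crit Y :
  (forall T (i : T ⟶ Y), simple T -> i <> 0 -> exists g : T ⟶ 𝟙, g <> 0) ->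
  trivial Y.
Proof.
move=> H; have [n [T [sT dT]]] := ssC.2 Y.
apply/trivialP; exists 'I_n, T; split=> // j.
case: (dT) => i [p [H1 _ _]].
have [|g gn0] := H _ (i j) (sT j).
  by move=> i0; case: (sT j) => + _; rewrite -H1 i0 compm0.
by exists g; exact: (schur ssC.1).
Qed.

Lemma trivial_retract X Y (f : Y ⟶ X) (r : X ⟶ Y) :
  r ∘ f = idm Y -> trivial X -> trivial Y.
Proof.
move=> rf [n [i [p [_ _ H3]]]]; apply: trivial_crit => T g sT gn0.
have [|j Hj] := dirsum_in_neq0 (g := f ∘ g) H3; last by exists (p j ∘ (f ∘ g)).
by move=> fg; apply: gn0; rewrite -(comp1m g) -rf -compA fg compm0.
Qed.

Lemma trivial_zagzig X Xs (ev : Xs ⊗ X ⟶ 𝟙) (coev : 𝟙 ⟶ X ⊗ Xs) :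
  zagzig ev coev -> trivial X -> trivial Xs.
Proof.
move=> zz [n [i [p [_ _ H3]]]]; apply: trivial_crit => T g sT gn0.
have En0 : ev ∘ (g ⊠ idm X) <> 0.
  move=> E; apply: gn0; rewrite -(comp1m g) -zz -!compA -ruI_nat.
  rewrite (compA (idm Xs ⊠ coev)) -tmor_swap -!compA (compA (asI _ _ _)).
  rewrite -tmor1 asI_nat !compA -(compA (lu Xs)) -tmorMl E tmor0l.
  by rewrite compm0 !comp0m.
have H3' : \sum_j ((idm T ⊠ i j) ∘ (idm T ⊠ p j)) = idm (T ⊗ X).
  under eq_bigr => j _ do rewrite -tmorMr.
  by rewrite -tmor_sumr H3 tmor1.
have [j Hj] := dirsum_out_neq0 H3' En0.
exists (ev ∘ (g ⊠ idm X) ∘ (idm T ⊠ i j) ∘ ruI T) => E; apply: Hj.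
by rewrite -[LHS]compm1 -ruK compA E comp0m.
Qed.

Lemma trivial_zigzag X Xs (ev : Xs ⊗ X ⟶ 𝟙) (coev : 𝟙 ⟶ X ⊗ Xs) :
  zigzag ev coev -> trivial Xs -> trivial X.
Proof.
move=> zz [n [i [p [_ _ H3]]]]; apply: trivial_crit => T g sT gn0.
have En0 : ev ∘ (idm Xs ⊠ g) <> 0.
  move=> E; apply: gn0; rewrite -(comp1m g) -zz -!compA -luI_nat.
  rewrite (compA (coev ⊠ idm X)) tmor_swap -!compA (compA (as_ _ _ _)).
  rewrite -tmor1 as_nat !compA -(compA (ru X)) -tmorMr E tmor0r.
  by rewrite compm0 !comp0m.
have H3' : \sum_j ((i j ⊠ idm T) ∘ (p j ⊠ idm T)) = idm (Xs ⊗ T).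
  under eq_bigr => j _ do rewrite -tmorMl.
  by rewrite -tmor_suml H3 tmor1.
have [j Hj] := dirsum_out_neq0 H3' En0.
exists (ev ∘ (idm Xs ⊠ g) ∘ (i j ⊠ idm T) ∘ luI T) => E; apply: Hj.
by rewrite -[LHS]compm1 -luK compA E comp0m.
Qed.

End MonFacts.

Section FunFacts.
Variables (k : fieldType) (C D : moncat k) (F : tfunctor C D).
Implicit Types X Y Z : C.

HB.instance Definition _ X Y :=
  GRing.isLinear.Build k (X ⟶ Y) (F X ⟶ F Y) *:%R
    (@fmor k C D F X Y) (@fmor_lin k C D F X Y).

Lemma fmor0 X Y : fmor F (0 : X ⟶ Y) = 0.
Proof. exact: linear0. Qed.

Lemma fmor_sum X Y (I : finType) (f : I -> (X ⟶ Y)) :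
  fmor F (\sum_i f i) = \sum_i fmor F (f i).
Proof. exact: linear_sum. Qed.

Lemma fmorB X Y (f g : X ⟶ Y) : fmor F (f - g) = fmor F f - fmor F g.
Proof. exact: linearB. Qed.

Lemma fmorZ X Y a (f : X ⟶ Y) : fmor F (a *: f) = a *: fmor F f.
Proof. exact: linearZ_LR. Qed.

Lemma fmor_dirsum (I : finType) (Y : I -> C) X :
  is_dirsum Y X -> is_dirsum (fun i => F (Y i)) (F X).
Proof.
move=> [i [p [H1 H2 H3]]]; exists (fun j => fmor F (i j)), (fun j => fmor F (p j)).
split.
- by move=> j; rewrite -fmorM H1 fmor1.
- by move=> j l ne; rewrite -fmorM H2 // fmor0.
- under eq_bigr => j _ do rewrite -fmorM.
  by rewrite -fmor_sum H3 fmor1.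
Qed.

Lemma muI_nat X X' Y Y' (f : X ⟶ X') (g : Y ⟶ Y') :
  (fmor F f ⊠ fmor F g) ∘ muI F X Y = muI F X' Y' ∘ fmor F (f ⊠ g).
Proof.
rewrite -[LHS]comp1m -(muK F X' Y') -compA (compA (mu F X' Y')) mu_nat.
by rewrite -compA muIK compm1.
Qed.

Definition fev X Xs (ev : Xs ⊗ X ⟶ 𝟙) : F Xs ⊗ F X ⟶ 𝟙 :=
  epsI F ∘ fmor F ev ∘ mu F Xs X.

Definition fcoev X Xs (coev : 𝟙 ⟶ X ⊗ Xs) : 𝟙 ⟶ F X ⊗ F Xs :=
  muI F X Xs ∘ fmor F coev ∘ eps F.

Lemma luI_fun X :
  luI (F X) = (epsI F ⊠ idm _) ∘ (muI F 𝟙 X ∘ fmor F (luI X)).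
Proof.
rewrite -[LHS]comp1m -[idm _]tmor1 -(epsK F) tmorMl -compA; congr (_ ∘ _).
apply: (split_mono_mono (muK F 𝟙 X)); rewrite [RHS]compA muIK comp1m.
rewrite -[LHS]comp1m -fmor1 -luK fmorM -!compA (compA (mu F _ _)) (compA (fmor F (lu X))).
by rewrite (compA (fmor F (lu X))) mu_lu luIK compm1.
Qed.

Lemma ruI_fun X :
  ruI (F X) = (idm _ ⊠ epsI F) ∘ (muI F X 𝟙 ∘ fmor F (ruI X)).
Proof.
rewrite -[LHS]comp1m -[idm _]tmor1 -(epsK F) tmorMr -compA; congr (_ ∘ _).
apply: (split_mono_mono (muK F X 𝟙)); rewrite [RHS]compA muIK comp1m.
rewrite -[LHS]comp1m -fmor1 -ruK fmorM -!compA (compA (mu F _ _)) (compA (fmor F (ru X))).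
by rewrite (compA (fmor F (ru X))) mu_ru ruIK compm1.
Qed.

Lemma muI_as X Y Z :
  as_ (F X) (F Y) (F Z) ∘ ((muI F X Y ⊠ idm _) ∘ muI F (X ⊗ Y) Z) =
  (idm _ ⊠ muI F Y Z) ∘ (muI F X (Y ⊗ Z) ∘ fmor F (as_ X Y Z)).
Proof.
apply: (split_mono_mono (f := mu F X (Y ⊗ Z) ∘ (idm _ ⊠ mu F Y Z))
          (r := (idm _ ⊠ muI F Y Z) ∘ muI F X (Y ⊗ Z))).
  by rewrite -compA (compA (muI F X _)) muK comp1m -tmorMr muK tmor1.
rewrite compA -mu_as -!compA (compA (mu F X Y ⊠ _)) -tmorMl muIK tmor1 comp1m.
by rewrite muIK compm1 (compA (idm _ ⊠ mu F Y Z)) -tmorMr muIK tmor1 comp1m compA muIK comp1m.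
Qed.

Lemma muI_asI X Y Z :
  asI (F X) (F Y) (F Z) ∘ ((idm _ ⊠ muI F Y Z) ∘ muI F X (Y ⊗ Z)) =
  (muI F X Y ⊠ idm _) ∘ (muI F (X ⊗ Y) Z ∘ fmor F (asI X Y Z)).
Proof.
rewrite -[RHS]comp1m -(asK (F X)) -compA; congr (_ ∘ _).
rewrite !compA -(compA (as_ _ _ _)) muI_as -!compA -fmorM asIK fmor1 compm1.
by [].
Qed.

Lemma luI_fcoev X Xs (coev : 𝟙 ⟶ X ⊗ Xs) Y :
  (fcoev coev ⊠ idm (F Y)) ∘ luI (F Y) =
  (muI F X Xs ⊠ idm _) ∘ (muI F (X ⊗ Xs) Y ∘ fmor F ((coev ⊠ idm Y) ∘ luI Y)).
Proof.
rewrite luI_fun /fcoev !tmorMl -!compA; congr (_ ∘ _).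
rewrite (compA (eps F ⊠ _)) -tmorMl epsIK tmor1 comp1m.
by rewrite fmorM [LHS]compA [RHS]compA -[idm (F Y)]fmor1 muI_nat.
Qed.

Lemma ruI_fcoev X Xs (coev : 𝟙 ⟶ X ⊗ Xs) Y :
  (idm (F Y) ⊠ fcoev coev) ∘ ruI (F Y) =
  (idm _ ⊠ muI F X Xs) ∘ (muI F Y (X ⊗ Xs) ∘ fmor F ((idm Y ⊠ coev) ∘ ruI Y)).
Proof.
rewrite ruI_fun /fcoev !tmorMr -!compA; congr (_ ∘ _).
rewrite (compA (_ ⊠ eps F)) -tmorMr epsIK tmor1 comp1m.
by rewrite fmorM [LHS]compA [RHS]compA -[idm (F Y)]fmor1 muI_nat.
Qed.

Lemma ru_fev X Xs (ev : Xs ⊗ X ⟶ 𝟙) Y :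
  ru (F Y) ∘ (idm _ ⊠ fev ev) =
  fmor F (ru Y ∘ (idm Y ⊠ ev)) ∘ (mu F Y (Xs ⊗ X) ∘ (idm _ ⊠ mu F Xs X)).
Proof.
rewrite /fev !tmorMr !compA; congr (_ ∘ _).
rewrite -mu_ru -!compA (compA (_ ⊠ eps F)) -tmorMr epsIK tmor1 comp1m.
by rewrite fmorM -!compA -mu_nat fmor1.
Qed.

Lemma lu_fev X Xs (ev : Xs ⊗ X ⟶ 𝟙) Y :
  lu (F Y) ∘ (fev ev ⊠ idm _) =
  fmor F (lu Y ∘ (ev ⊠ idm Y)) ∘ (mu F (Xs ⊗ X) Y ∘ (mu F Xs X ⊠ idm _)).
Proof.
rewrite /fev !tmorMl !compA; congr (_ ∘ _).
rewrite -mu_lu -!compA (compA (eps F ⊠ _)) -tmorMl epsIK tmor1 comp1m.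
by rewrite fmorM -!compA -mu_nat fmor1.
Qed.

Lemma fun_zigzag X Xs (ev : Xs ⊗ X ⟶ 𝟙) (coev : 𝟙 ⟶ X ⊗ Xs) :
  zigzag ev coev -> zigzag (fev ev) (fcoev coev).
Proof.
move=> zz; rewrite /zigzag ru_fev -!compA luI_fcoev.
rewrite (compA (muI F X Xs ⊠ _)) (compA (as_ _ _ _)) muI_as -!compA.
rewrite (compA (idm _ ⊠ mu F _ _)) -tmorMr muIK tmor1 comp1m.
by rewrite (compA (mu F _ _)) muIK comp1m -!fmorM !compA zz fmor1.
Qed.

Lemma fun_zagzig X Xs (ev : Xs ⊗ X ⟶ 𝟙) (coev : 𝟙 ⟶ X ⊗ Xs) :
  zagzig ev coev -> zagzig (fev ev) (fcoev coev).
Proof.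
move=> zz; rewrite /zagzig lu_fev -!compA ruI_fcoev.
rewrite (compA (_ ⊠ muI F X Xs)) (compA (asI _ _ _)) muI_asI -!compA.
rewrite (compA (mu F _ _ ⊠ _)) -tmorMl muIK tmor1 comp1m.
by rewrite (compA (mu F _ _)) muIK comp1m -!fmorM !compA zz fmor1.
Qed.

End FunFacts.

Section MuNat.
Variables (k : fieldType) (C D : moncat k) (F : tfunctor C D).

Lemma mu_natl (X X' Y : C) (f : X ⟶ X') :
  mu F X' Y ∘ (fmor F f ⊠ idm (F Y)) = fmor F (f ⊠ idm Y) ∘ mu F X Y.
Proof. by rewrite -fmor1 mu_nat. Qed.

Lemma mu_natr (X Y Y' : C) (g : Y ⟶ Y') :
  mu F X Y' ∘ (idm (F X) ⊠ fmor F g) = fmor F (idm X ⊠ g) ∘ mu F X Y.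
Proof. by rewrite -fmor1 mu_nat. Qed.

End MuNat.

Section Comp.
Variables (k : fieldType) (C D E : moncat k).
Variables (G : tfunctor D E) (F : tfunctor C D).

Definition tf_comp : tfunctor C E.
Proof.
refine (@TFunctor k C E (fun X => G (F X)) (fun X Y f => fmor G (fmor F f))
  _ _ _
  (fun X Y => fmor G (mu F X Y) ∘ mu G (F X) (F Y))
  (fun X Y => muI G (F X) (F Y) ∘ fmor G (muI F X Y))
  (fmor G (eps F) ∘ eps G) (epsI G ∘ fmor G (epsI F)) _ _ _ _ _ _ _ _).
- by move=> X; rewrite !fmor1.
- by move=> X Y Z g f; rewrite !fmorM.
- by move=> X Y a f g; rewrite !fmor_lin.
- move=> X Y; rewrite -compA (compA (fmor G _)) -fmorM muK fmor1 comp1m.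
  exact: muK.
- move=> X Y; rewrite -compA (compA (mu G _ _)) muIK comp1m -fmorM muIK.
  exact: fmor1.
- by rewrite -compA (compA (fmor G _)) -fmorM epsK fmor1 comp1m epsK.
- by rewrite -compA (compA (eps G)) epsIK comp1m -fmorM epsIK fmor1.
- by move=> X X' Y Y' f g; rewrite /= -compA mu_nat !compA -!fmorM mu_nat.
- move=> X Y Z /=; rewrite tmorMl tmorMr -!compA.
  rewrite (compA (mu G (F (X ⊗ Y)) _)) mu_natl (compA (mu G (F X) _)) mu_natr.
  rewrite !compA -!fmorM mu_as fmorM -!compA; congr (_ ∘ _).
  by rewrite !compA mu_as.
- move=> X /=; rewrite tmorMl -!compA (compA (mu G (F 𝟙) _)) mu_natl.
  by rewrite !compA -!fmorM mu_lu mu_lu.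
- move=> X /=; rewrite tmorMr -!compA (compA (mu G _ (F 𝟙))) mu_natr.
  by rewrite !compA -!fmorM mu_ru mu_ru.
Defined.

End Comp.

Section FullSub.
Variables (k : fieldType) (C : moncat k) (P : C -> Prop).

Definition full_lincat : lincat k :=
  @LinCat k {X : C | P X} (fun X Y => sval X ⟶ sval Y)
    (fun X => idm (sval X)) (fun X Y Z g f => g ∘ f)
    (fun X Y f => comp1m f) (fun X Y f => compm1 f)
    (fun X Y Z W h g f => compA h g f)
    (fun X Y Z g => @comp_linr k C _ _ _ g)
    (fun X Y Z f => @comp_linl k C _ _ _ f).

Hypotheses (P1 : P 𝟙) (PT : forall X Y, P X -> P Y -> P (X ⊗ Y)).

Definition full_moncat : moncat k :=
  @MonCat k full_lincat
    (fun X Y => exist P (sval X ⊗ sval Y) (PT (svalP X) (svalP Y)))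
    (fun X X' Y Y' f g => f ⊠ g)
    (exist P 𝟙 P1)
    (fun X Y Z => as_ (sval X) (sval Y) (sval Z))
    (fun X Y Z => asI (sval X) (sval Y) (sval Z))
    (fun X => lu (sval X)) (fun X => luI (sval X))
    (fun X => ru (sval X)) (fun X => ruI (sval X))
    (fun X Y => tmor1 (sval X) (sval Y))
    (fun _ _ _ _ _ _ f' f g' g => tmorM f' f g' g)
    (fun _ _ _ _ f => @tmor_linr k C _ _ _ _ f)
    (fun _ _ _ _ g => @tmor_linl k C _ _ _ _ g)
    (fun X Y Z => asK (sval X) (sval Y) (sval Z))
    (fun X Y Z => asIK (sval X) (sval Y) (sval Z))
    (fun X => luK (sval X)) (fun X => luIK (sval X))
    (fun X => ruK (sval X)) (fun X => ruIK (sval X))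
    (fun _ _ _ _ _ _ f g h => as_nat f g h)
    (fun _ _ f => lu_nat f) (fun _ _ f => ru_nat f)
    (fun X Y Z W => pentagon (sval X) (sval Y) (sval Z) (sval W))
    (fun X Y => triangle (sval X) (sval Y)).

End FullSub.

Section FullSubFusion.
Variables (k : fieldType) (C : fusioncat k) (P : C -> Prop).
Hypotheses (P1 : P 𝟙) (PT : forall X Y, P X -> P Y -> P (X ⊗ Y)).
Hypothesis PR : forall X Y (f : Y ⟶ X) (r : X ⟶ Y), r ∘ f = idm Y -> P X -> P Y.
Hypothesis PS : forall n (Y : 'I_n -> C) X,
  (forall i, P (Y i)) -> is_dirsum Y X -> P X.
Hypothesis PL : forall X Xs, is_dual Xs X -> P X -> P Xs.
Hypothesis PD : forall X Xs, is_dual Xs X -> P Xs -> P X.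

Let M := full_moncat P1 PT.

Lemma fus_mono_split (X Y : C) (f : X ⟶ Y) : mono f -> exists r, r ∘ f = idm X.
Proof.
case: (fusP C) => ss _ [I [S irrS]] sp _; exact: (mono_split ss sp irrS).
Qed.

Lemma fus_epi_split (X Y : C) (f : X ⟶ Y) : epi f -> exists r, f ∘ r = idm Y.
Proof.
case: (fusP C) => ss _ [I [S irrS]] sp _; exact: (epi_split ss sp irrS).
Qed.

Lemma full_mono (X Y : M) (f : X ⟶ Y) : mono f -> @mono k C _ _ f.
Proof.
move=> mf; apply: mono0P => Z g fg.
have [K [i Ki]] := ab_kernel (fus_semisimple (fusP C)).1 (f : sval X ⟶ sval Y).
have [r ri] := fus_mono_split (kernel_mono Ki).
have PK : P K := PR ri (svalP X).
case: Ki => fi /(_ _ g fg) [h [<- _]].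
rewrite (mf (exist _ K PK : M) i 0); first by rewrite comp0m.
by rewrite [RHS](compm0 (C := M)).
Qed.

Lemma full_epi (X Y : M) (f : X ⟶ Y) : epi f -> @epi k C _ _ f.
Proof.
move=> mf; apply: epi0P => Z g fg.
have [K [i Ki]] := ab_cokernel (fus_semisimple (fusP C)).1 (f : sval X ⟶ sval Y).
have [r ri] := fus_epi_split (cokernel_epi Ki).
have PK : P K := PR ri (svalP Y).
case: Ki => fi /(_ _ g fg) [h [<- _]].
rewrite (mf (exist _ K PK : M) i 0); first by rewrite compm0.
by rewrite [RHS](comp0m (C := M)).
Qed.

Lemma full_simple (X : M) : simple X <-> @simple k C (sval X).
Proof.
split=> [] [X0 sX]; split=> // Y f mf.
  have [r rf] := fus_mono_split mf.
  have PY : P Y := PR rf (svalP X).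
  by apply: (sX (exist _ Y PY : M) f) => Z g h; exact: mf.
exact: (sX (sval Y) f (full_mono mf)).
Qed.

Lemma full_fusion : is_fusion M.
Proof.
have [[abC ssC] rgC [I [S [sS injS surjS]]] spC s1] := fusP C.
have abM : @abelian k M.
  split.
  - move=> n Y; have [X dX] := ab_dirsum abC (fun j => sval (Y j)).
    by exists (exist _ X (PS (fun j => svalP (Y j)) dX)).
  - move=> X Y f; have [K [i Ki]] := ab_kernel abC (f : sval X ⟶ sval Y).
    have [r ri] := fus_mono_split (kernel_mono Ki).
    exists (exist _ K (PR ri (svalP X))), i.
    by case: Ki => fi Hi; split=> // Z g; exact: Hi.
  - move=> X Y f; have [K [i Ki]] := ab_cokernel abC (f : sval X ⟶ sval Y).
    have [r ri] := fus_epi_split (cokernel_epi Ki).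
    exists (exist _ K (PR ri (svalP Y))), i.
    by case: Ki => fi Hi; split=> // Z g; exact: Hi.
  - move=> X Y f /full_mono/fus_mono_split[r rf]; exists Y, (idm (sval Y) - f ∘ r).
    exact: (split_mono_kernel (C := M) rf).
  - move=> X Y f /full_epi/fus_epi_split[r rf]; exists X, (idm (sval X) - r ∘ f).
    exact: (split_epi_cokernel (C := M) rf).
split.
- split=> [|X]; first exact: abM.
  have [n [T [sT dT]]] := ssC (sval X).
  have PTj j : P (T j).
    by case: (dT) => i [p [H1 _ _]]; exact: PR (H1 j) (svalP X).
  exists n, (fun j => exist _ (T j) (PTj j) : M); split=> // j.
  exact: ((full_simple (exist _ (T j) (PTj j) : M)).2 (sT j)).
- move=> X; have [[Xs dXs] [sX dsX]] := rgC (sval X); split.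
    by exists (exist _ Xs (PL dXs (svalP X))).
  by exists (exist _ sX (PD dsX (svalP X))).
- exists {i : I | `[< P (S i) >]}.
  exists (fun i => exist _ (S (sval i)) (asboolW (svalP i))); split.
  + by move=> i; apply/full_simple; exact: sS.
  + by move=> i j H; apply: val_inj; exact: injS.
  + move=> X /full_simple /surjS [i [f [g [gf fg]]]].
    have Pi : `[< P (S i) >] by apply/asboolP; exact: PR fg (svalP X).
    by exists (exist _ i Pi); exists f, g.
- by move=> T /full_simple; exact: spC.
- exact: ((full_simple (exist _ 𝟙 P1 : M)).2 s1).
Qed.

End FullSubFusion.

Section Restrict.
Variables (k : fieldType) (C D : moncat k) (F : tfunctor C D).
Variables (P : C -> Prop) (Q : D -> Prop).
Hypotheses (P1 : P 𝟙) (PT : forall X Y, P X -> P Y -> P (X ⊗ Y)).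
Hypotheses (Q1 : Q 𝟙) (QT : forall X Y, Q X -> Q Y -> Q (X ⊗ Y)).
Hypothesis PQ : forall X, P X -> Q (F X).

Definition restrict : tfunctor (full_moncat P1 PT) (full_moncat Q1 QT) :=
  @TFunctor k (full_moncat P1 PT) (full_moncat Q1 QT)
    (fun X => exist Q (F (sval X)) (PQ (svalP X)))
    (fun X Y f => fmor F f)
    (fun X => fmor1 F (sval X))
    (fun _ _ _ g f => fmorM F g f)
    (fun X Y => @fmor_lin k C D F _ _)
    (fun X Y => mu F (sval X) (sval Y))
    (fun X Y => muI F (sval X) (sval Y))
    (eps F) (epsI F)
    (fun X Y => muK F (sval X) (sval Y))
    (fun X Y => muIK F (sval X) (sval Y))
    (epsK F) (epsIK F)
    (fun _ _ _ _ f g => mu_nat F f g)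
    (fun X Y Z => mu_as F (sval X) (sval Y) (sval Z))
    (fun X => mu_lu F (sval X))
    (fun X => mu_ru F (sval X)).

End Restrict.

Section Ker.
Variables (k : fieldType) (C D : fusioncat k) (F : tfunctor C D).

Definition in_ker (X : C) : Prop := trivial (F X).

Lemma in_ker_unit : in_ker 𝟙.
Proof.
apply: trivial_iso (trivial_unit D); exists (eps F), (epsI F).
by rewrite epsK epsIK.
Qed.

Lemma in_ker_tensor X Y : in_ker X -> in_ker Y -> in_ker (X ⊗ Y).
Proof.
move=> HX HY; apply: trivial_iso (trivial_tensor HX HY).
by exists (mu F X Y), (muI F X Y); rewrite muK muIK.
Qed.

Lemma in_ker_fusion : is_fusion (full_moncat in_ker_unit in_ker_tensor).
Proof.
have [ssD _ _ _ s1] := fusP D.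
apply: full_fusion.
- move=> X Y f r rf HX.
  by apply: (trivial_retract ssD s1 (f := fmor F f) (r := fmor F r)) HX; rewrite -fmorM rf fmor1.
- move=> n Y X HY dX; exact: trivial_dirsum HY (fmor_dirsum F dX).
- move=> X Xs [ev [coev [_ /(fun_zagzig F) zz]]].
  exact: (trivial_zagzig ssD s1 zz).
- move=> X Xs [ev [coev [/(fun_zigzag F) zz _]]].
  exact: (trivial_zigzag ssD s1 zz).
Qed.

Definition Ker : fusioncat k := FusionCat in_ker_fusion.

Definition ker_ob (X : Ker) : C := sval X.

Definition dominant : Prop :=
  forall Y : D, simple Y -> exists X : C, simple X /\ factor Y (F X).

Definition normal : Prop :=
  forall X : C, simple X -> factor 𝟙 (F X) -> trivial (F X).

End Ker.

Definition ker_restrict (k : fieldType) (C D C' D' : fusioncat k)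
    (G : tfunctor C D) (G' : tfunctor C' D') (F : tfunctor C C')
    (h : forall X, in_ker G X -> in_ker G' (F X)) : tfunctor (Ker G) (Ker G') :=
  restrict (in_ker_unit G) (@in_ker_tensor k C D G)
    (in_ker_unit G') (@in_ker_tensor k C' D' G') h.

Section FPdim.
Variables (R : realType) (k : fieldType) (C : fusioncat k).

Definition irr_idx : finType := sval (cid (fus_finite (fusP C))).

Definition irr : irr_idx -> C := sval (cid (svalP (cid (fus_finite (fusP C))))).

Lemma irrP : is_irr irr.
Proof. exact: (svalP (cid (svalP (cid (fus_finite (fusP C)))))). Qed.

(* Left multiplication by [X] on the Grothendieck ring, in the basis of simple
   classes: row j holds the coordinates of [X][S_j]. Since End(S_l) = k, the
   multiplicity of S_l in an object Y is dim Hom(S_l, Y). *)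
Definition lmul_mx (X : C) : 'M[R]_#|irr_idx| :=
  \matrix_(j, l) (\dim {: irr (enum_val l) ⟶ X ⊗ irr (enum_val j)})%:R.

(* The Frobenius-Perron eigenvalue of a nonnegative matrix is its largest
   nonnegative eigenvalue. *)
Definition FPdim_ob (X : C) : R :=
  sup [set x : R | 0 <= x /\ eigenvalue (lmul_mx X) x]%classic.

Definition FPdim : R := \sum_(i : irr_idx) FPdim_ob (irr i) ^+ 2.

End FPdim.

Definition FPindex (R : realType) (k : fieldType) (C D : fusioncat k) : R :=
  FPdim R C / FPdim R D.

Section Center.
Variables (k : fieldType) (C : moncat k).

Definition is_half_braiding (A : C) (s : forall X, A ⊗ X ⟶ X ⊗ A) : Prop :=
  [/\ forall X, is_iso (s X),
      forall X X' (f : X ⟶ X'), s X' ∘ (idm A ⊠ f) = (f ⊠ idm A) ∘ s X &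
      forall X Y, s (X ⊗ Y) =
        asI X Y A ∘ (idm X ⊠ s Y) ∘ as_ X A Y ∘ (s X ⊠ idm Y) ∘ asI A X Y].

Definition unit_braiding (X : C) : 𝟙 ⊗ X ⟶ X ⊗ 𝟙 := ruI X ∘ lu X.

Definition tensor_braiding (A B : C) (s : forall X, A ⊗ X ⟶ X ⊗ A)
    (t : forall X, B ⊗ X ⟶ X ⊗ B) (X : C) : (A ⊗ B) ⊗ X ⟶ X ⊗ (A ⊗ B) :=
  as_ X A B ∘ (s X ⊠ idm B) ∘ asI A X B ∘ (idm A ⊠ t X) ∘ as_ A B X.

Definition central_mor (A B : C) (s : forall X, A ⊗ X ⟶ X ⊗ A)
    (t : forall X, B ⊗ X ⟶ X ⊗ B) (f : A ⟶ B) : Prop :=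
  forall X, (idm X ⊠ f) ∘ s X = t X ∘ (f ⊠ idm X).

Record central_data := CentralData {
  cd_ob : C;
  cd_braid : forall X, cd_ob ⊗ X ⟶ X ⊗ cd_ob;
  cd_mul : cd_ob ⊗ cd_ob ⟶ cd_ob;
  cd_one : 𝟙 ⟶ cd_ob
}.

(* [A] is a commutative algebra in the center; the last clause is
   commutativity, as the braiding of the center from (A, s) to itself is s A. *)
Record is_comm_central_algebra (A : central_data) : Prop := CommCentralAlgebra {
  cca_braid : is_half_braiding (cd_braid A);
  cca_mul : central_mor (tensor_braiding (cd_braid A) (cd_braid A))
    (cd_braid A) (cd_mul A);
  cca_one : central_mor unit_braiding (cd_braid A) (cd_one A);
  cca_assoc : cd_mul A ∘ (cd_mul A ⊠ idm _) =
    cd_mul A ∘ (idm _ ⊠ cd_mul A) ∘ as_ _ _ _;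
  cca_onel : cd_mul A ∘ (cd_one A ⊠ idm _) = lu _;
  cca_oner : cd_mul A ∘ (idm _ ⊠ cd_one A) = ru _;
  cca_comm : cd_mul A ∘ cd_braid A (cd_ob A) = cd_mul A
}.

(* A morphism of the center which is monic in C is monic in the center. *)
Definition is_central_subalgebra (A B : central_data) : Prop :=
  exists i : cd_ob A ⟶ cd_ob B,
    [/\ mono i, central_mor (cd_braid A) (cd_braid B) i,
        i ∘ cd_mul A = cd_mul B ∘ (i ⊠ i) &
        i ∘ cd_one A = cd_one B].

End Center.

Record right_adjoint (k : fieldType) (C D : moncat k) (F : tfunctor C D) :=
  RightAdjoint {
  rob : D -> C;
  rmor : forall X Y : D, (X ⟶ Y) -> (rob X ⟶ rob Y);
  rmor1 : forall X, rmor (idm X) = idm (rob X);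
  rmorM : forall X Y Z (g : Y ⟶ Z) (f : X ⟶ Y), rmor (g ∘ f) = rmor g ∘ rmor f;
  adj_unit : forall X : C, X ⟶ rob (F X);
  adj_counit : forall Y : D, F (rob Y) ⟶ Y;
  unit_nat : forall X X' (f : X ⟶ X'),
    adj_unit X' ∘ f = rmor (fmor F f) ∘ adj_unit X;
  counit_nat : forall Y Y' (f : Y ⟶ Y'),
    adj_counit Y' ∘ fmor F (rmor f) = f ∘ adj_counit Y;
  adj_trl : forall X, adj_counit (F X) ∘ fmor F (adj_unit X) = idm (F X);
  adj_trr : forall Y, rmor (adj_counit Y) ∘ adj_unit (rob Y) = idm (rob Y)
}.

Arguments rob {k C D F} r Y.
Arguments rmor {k C D F} r {X Y} f.
Arguments adj_unit {k C D F} r X.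
Arguments adj_counit {k C D F} r Y.

(* The inverse of [f] if [f] is an isomorphism, and 0 otherwise. *)
Definition minv (k : fieldType) (C : lincat k) (X Y : C) (f : X ⟶ Y) : Y ⟶ X :=
  xget (0 : Y ⟶ X) [set g | g ∘ f = idm X /\ f ∘ g = idm Y]%classic.

Section Induced.
Variables (k : fieldType) (C D : moncat k) (F : tfunctor C D).
Variable (R : right_adjoint F).

Definition lax_mu (X Y : D) : rob R X ⊗ rob R Y ⟶ rob R (X ⊗ Y) :=
  rmor R ((adj_counit R X ⊠ adj_counit R Y) ∘ muI F (rob R X) (rob R Y)) ∘
  adj_unit R (rob R X ⊗ rob R Y).

Definition lax_eps : 𝟙 ⟶ rob R 𝟙 := rmor R (epsI F) ∘ adj_unit R 𝟙.

(* The natural maps X ⊗ R(Y) -> R(FX ⊗ Y) and R(Y) ⊗ X -> R(Y ⊗ FX) at Y = 𝟙,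
   followed by R of the unit constraint. They are invertible when C is rigid;
   the half-braiding is ind_r^-1 ∘ ind_l. *)
Definition ind_r (X : C) : X ⊗ rob R 𝟙 ⟶ rob R (F X) :=
  rmor R (ru (F X)) ∘ lax_mu (F X) 𝟙 ∘ (adj_unit R X ⊠ idm (rob R 𝟙)).

Definition ind_l (X : C) : rob R 𝟙 ⊗ X ⟶ rob R (F X) :=
  rmor R (lu (F X)) ∘ lax_mu 𝟙 (F X) ∘ (idm (rob R 𝟙) ⊠ adj_unit R X).

Definition induced_central_algebra : central_data C :=
  @CentralData k C (rob R 𝟙)
    (fun X => minv (ind_r X) ∘ ind_l X)
    (rmor R (lu 𝟙) ∘ lax_mu 𝟙 𝟙)
    lax_eps.

End Induced.

Section UniversalArrow.
Variables (k : fieldType) (C D : moncat k) (F : tfunctor C D).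
Variables (r : D -> C) (e : forall Y, F (r Y) ⟶ Y).
Hypothesis univ : forall Y X (f : F X ⟶ Y),
  exists! g : X ⟶ r Y, e Y ∘ fmor F g = f.

Let tr Y X (f : F X ⟶ Y) : X ⟶ r Y := sval (cid (univ f)).

Let trE Y X (f : F X ⟶ Y) : e Y ∘ fmor F (tr f) = f.
Proof. exact: (svalP (cid (univ f))).1. Qed.

Let trU Y X (g h : X ⟶ r Y) : e Y ∘ fmor F g = e Y ∘ fmor F h -> g = h.
Proof. by move=> E; have [u [_ U]] := univ (e Y ∘ fmor F h); rewrite -(U g) // -(U h). Qed.

Lemma universal_arrow_adjoint : right_adjoint F.
Proof.
refine (@RightAdjoint k C D F r (fun X Y f => tr (f ∘ e X)) _ _
  (fun X => tr (idm (F X))) e _ _ _ _).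
- by move=> X; apply: trU; rewrite trE fmor1 comp1m compm1.
- by move=> X Y Z g f; apply: trU; rewrite trE fmorM compA trE -!compA trE.
- move=> X X' f; apply: trU; rewrite !fmorM !compA !trE comp1m -compA trE.
  by rewrite compm1.
- by move=> Y Y' f; rewrite trE.
- by move=> X; rewrite trE.
- by move=> Y; apply: trU; rewrite fmorM compA trE -compA trE fmor1 !compm1.
Qed.

End UniversalArrow.

Lemma right_adjoint_exists (k : fieldType) (C : fusioncat k) (D : moncat k)
  (F : tfunctor C D) : inhabited (right_adjoint F).
Proof.
case: (fusP C) => ss _ [I [S irrS]] sp _.
suff H (Y : D) : exists (r : C) (e : F r ⟶ Y), forall X (f : F X ⟶ Y),
    exists! g : X ⟶ r, e ∘ fmor F g = f.
  pose r Y := sval (cid (H Y)).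
  pose e Y := sval (cid (svalP (cid (H Y)))).
  constructor; apply: (universal_arrow_adjoint (r := r) (e := e)) => Y.
  exact: (svalP (cid (svalP (cid (H Y))))).
pose J := {i : I & 'I_(\dim {: F (S i) ⟶ Y})}.
pose mk i (l : 'I_(\dim {: F (S i) ⟶ Y})) : J :=
  Tagged (fun i => 'I_(\dim {: F (S i) ⟶ Y})) l.
pose b i := vbasis {: F (S i) ⟶ Y}.
have [X0 d0] := ab_dirsum ss.1 (fun j : 'I_#|{: J}| => S (tag (enum_val j))).
have [inj [pr [K1 K2 K3]]] : is_dirsum (fun u : J => S (tag u)) X0.
  have := dirsum_reindex (h := @enum_rank J) (@enum_rank_bij J) d0.
  by apply: dirsum_isoY => u; rewrite enum_rankK; exact: isomorphic_refl.
pose e : F X0 ⟶ Y := \sum_(u : J) ((b (tag u))`_(tagged u) ∘ fmor F (pr u)).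
pose inj' a l : S a ⟶ X0 := inj (mk a l).
pose pr' a l : X0 ⟶ S a := pr (mk a l).
have eE (u : J) : e ∘ fmor F (inj u) = (b (tag u))`_(tagged u).
  rewrite /e comp_suml (bigD1 u) //= big1 ?addr0 => [|v ne].
    by rewrite -compA -fmorM K1 fmor1 compm1.
  by rewrite -compA -fmorM K2 1?eq_sym // fmor0 compm0.
have eE' a l : e ∘ fmor F (inj' a l) = (b a)`_l by exact: (eE (mk a l)).
exists X0, e => X f.
have [n [c [i [p [H1 H2 H3]]]]] := irr_decomp ss irrS X.
have inj0 a (h : S a ⟶ X0) : e ∘ fmor F h = 0 -> h = 0.
  move=> eh.
  have Hc l : exists t, pr' a l ∘ h = t *: idm (S a).
    by apply: sp; case: irrS.
  pose t l := sval (cid (Hc l)).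
  have hE : h = \sum_l (t l *: inj' a l).
    rewrite -[LHS]comp1m -K3 comp_suml.
    transitivity (\sum_a' \sum_l (inj' a' l ∘ pr' a' l ∘ h)).
      rewrite sig_big_dep; apply: eq_bigr; case=> a' l _.
      by [].
    rewrite (bigD1 a) //= [X in _ + X]big1 ?addr0.
      apply: eq_bigr => l _.
      by rewrite -compA (svalP (cid (Hc l))) compZr compm1.
    move=> a' ne; apply: big1 => l _.
    rewrite -compA (irr_hom ss irrS (pr' a' l ∘ h)) ?compm0 //.
    by apply/eqP; rewrite eq_sym.
  have t0 : forall l, t l = 0.
    have /freeP/(_ t) := basis_free (vbasisP {: F (S a) ⟶ Y}); apply.
    rewrite -[RHS]eh [in RHS]hE fmor_sum comp_sumr; apply: eq_bigr => l _.
    by rewrite fmorZ compZr eE'.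
  by rewrite hE big1 // => l _; rewrite t0 scale0r.
pose g0 j : S (c j) ⟶ X0 :=
  \sum_l (coord (b (c j)) l (f ∘ fmor F (i j)) *: inj' (c j) l).
have g0E j : e ∘ fmor F (g0 j) = f ∘ fmor F (i j).
  rewrite [RHS](coord_vbasis (memvf _)) /g0 fmor_sum comp_sumr.
  by apply: eq_bigr => l _; rewrite fmorZ compZr eE'.
exists (\sum_j (g0 j ∘ p j)); split.
  rewrite fmor_sum comp_sumr -[RHS]compm1 -fmor1 -H3 fmor_sum comp_sumr.
  by apply: eq_bigr => j _; rewrite !fmorM !compA g0E.
move=> g gE; rewrite -[RHS]compm1 -H3 comp_sumr; apply: eq_bigr => j _.
rewrite compA; congr (_ ∘ _); apply/eqP; rewrite -subr_eq0; apply/eqP/inj0.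
by rewrite fmorB compBr g0E fmorM compA gE subrr.
Qed.

(* Main.v *)
(* Write A = R(1) for the right adjoint R of F, with counit e : F(A) -> 1. A
   morphism W -> X ⊗ A is determined by its composite with the projection
   ru (id ⊠ e) : F(X ⊗ A) = FX ⊗ FA -> FX, every morphism FW -> FX arises in this
   way (by rigidity), and symmetrically for A ⊗ X; the half-braiding is the
   isomorphism exchanging the two projections. Every axiom of a commutative
   central algebra, and the compatibilities of the map A'' -> A transposing
   F'(e''), reduce to identities between projections. That map is monic because
   a tensor functor kills no nonzero morphism to 1.

   On Ker F, where F takes trivial values, FPdim(X) = dim Hom(1, FX). For a
   dominant G : X -> Y and an additive multiplicative dimension d on Y, put
   r(Y) = \sum_i d(G S_i) dim Hom(G S_i, Y). As r(GX ⊗ Y) = d(GX) r(Y), the simple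
   objects minimizing r/d are stable under passing to constituents of GX ⊗ Y,
   hence are all simple objects, so r = r(1) d and FPdim(X) = r(1) FPdim(Y).
   Finally r(1) exceeds FPdim(Ker G) by the sum of
   d(G S_i) dim Hom(G S_i, 1) over the S_i outside Ker G, which vanishes exactly
   when G is normal. *)

From HB Require Import structures.
From mathcomp Require Import all_boot all_order all_algebra.
From mathcomp Require Import boolp classical_sets reals.
Require Import Defs.

Set Implicit Arguments.
Unset Strict Implicit.
Unset Printing Implicit Defensive.

Import Order.TTheory GRing.Theory Num.Theory.
Local Open Scope ring_scope.
Local Open Scope cat_scope.

(** Makes an equation usable at the head of a right-nested chain, where [a ∘ b] is not a subterm. *)
Lemma reassoc (k : fieldType) (C : lincat k) (X Y Z : C)
    (a : Y ⟶ Z) (b : X ⟶ Y) (c : X ⟶ Z) :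
  a ∘ b = c -> forall W (z : W ⟶ X), a ∘ (b ∘ z) = c ∘ z.
Proof. by move=> <- W z; rewrite compA. Qed.

Lemma mu_asI (k : fieldType) (C D : moncat k) (F : tfunctor C D) (X Y Z : C) :
  fmor F (asI X Y Z) ∘ mu F X (Y ⊗ Z) ∘ (idm (F X) ⊠ mu F Y Z) =
  mu F (X ⊗ Y) Z ∘ (mu F X Y ⊠ idm (F Z)) ∘ asI (F X) (F Y) (F Z).
Proof.
apply: (split_mono_mono (f := fmor F (as_ X Y Z)) (r := fmor F (asI X Y Z))).
  by rewrite -fmorM asK fmor1.
rewrite -!compA (reassoc (esym (fmorM F _ _))) asIK fmor1 comp1m !compA.
by rewrite mu_as -compA asIK compm1.
Qed.

(** * Reversal of the tensor product *)

Section Reverse.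
Variables (k : fieldType).

(** A lemma applied to the reversed category is its left-right mirror by conversion, which is why
    the construction ends with [Defined]. *)
Definition rev_moncat (C : moncat k) : moncat k.
Proof.
refine (@MonCat k C (fun X Y => Y ⊗ X) (fun X X' Y Y' f g => g ⊠ f) 𝟙
  (fun X Y Z => asI Z Y X) (fun X Y Z => as_ Z Y X)
  (@ru k C) (@ruI k C) (@lu k C) (@luI k C) _ _ _ _ _ _ _ _ _ _ _ _ _ _ _).
- by move=> X Y; rewrite tmor1.
- by move=> *; rewrite tmorM.
- by move=> X X' Y Y' f; apply: tmor_linl.
- by move=> X X' Y Y' f; apply: tmor_linr.
- by move=> *; rewrite asIK.
- by move=> *; rewrite asK.
- exact: ruK.
- exact: ruIK.
- exact: luK.
- exact: luIK.
- by move=> *; rewrite asI_nat.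
- exact: ru_nat.
- exact: lu_nat.
- move=> X Y Z W.
  apply: (split_mono_mono (f := as_ W Z (Y ⊗ X) ∘ as_ (W ⊗ Z) Y X)
            (r := asI (W ⊗ Z) Y X ∘ asI W Z (Y ⊗ X))).
    by rewrite -!compA (reassoc (asK _ _ _)) comp1m asK.
  rewrite [in RHS]pentagon -!compA (reassoc (asIK _ _ _)) comp1m asIK.
  rewrite (reassoc (esym (tmorMl _ _ _))) asIK tmor1 comp1m.
  by rewrite (reassoc (asIK _ _ _)) comp1m -tmorMr asIK tmor1.
- by move=> X Y; rewrite -triangle -compA asIK compm1.
Defined.

Definition rev_tfunctor (C D : moncat k) (F : tfunctor C D) :
  tfunctor (rev_moncat C) (rev_moncat D).
Proof.
refine (@TFunctor k (rev_moncat C) (rev_moncat D) F (@fmor k C D F)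
  (fmor1 F) (@fmorM k C D F) (@fmor_lin k C D F)
  (fun X Y => mu F Y X) (fun X Y => muI F Y X) (eps F) (epsI F)
  _ _ (epsK F) (epsIK F) _ _ _ _).
- by move=> X Y; apply: muK.
- by move=> X Y; apply: muIK.
- by move=> *; apply: mu_nat.
- by move=> X Y Z; apply: mu_asI.
- exact: (mu_ru F).
- exact: (mu_lu F).
Defined.

End Reverse.

(** * Unit coherence and transposition along a dual pair *)

Section Coherence.
Variables (k : fieldType) (C : moncat k).
Implicit Types X Y Z : C.

Lemma tmor1_injr X Y (f g : X ⟶ Y) : f ⊠ idm 𝟙 = g ⊠ idm 𝟙 -> f = g.
Proof. by move=> e; rewrite -(compm1 f) -(compm1 g) -ruIK !compA -!ru_nat e. Qed.

(** Kelly's argument: after tensoring with [𝟙] and composing with an associator, pentagon and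
    triangle bring both sides to the same morphism. *)
Lemma ru_tensor X Y : (idm X ⊠ ru Y) ∘ as_ X Y 𝟙 = ru (X ⊗ Y).
Proof.
apply: tmor1_injr; apply: (split_mono_mono (asK X Y 𝟙)).
rewrite -[in RHS]triangle -[in RHS]tmor1 [RHS]compA as_nat -[RHS]compA pentagon.
rewrite !compA -(tmorMr _ (idm Y ⊠ lu 𝟙)) triangle -as_nat -[RHS]compA.
by rewrite -tmorMl.
Qed.

End Coherence.

Section CoherenceMirror.
Variables (k : fieldType) (C : moncat k).
Implicit Types X Y Z : C.

Lemma lu_tensor X Y : (lu X ⊠ idm Y) ∘ asI 𝟙 X Y = lu (X ⊗ Y).
Proof. exact: (@ru_tensor k (rev_moncat C) Y X). Qed.

Lemma lu_tensor_as X Y : lu (X ⊗ Y) ∘ as_ 𝟙 X Y = lu X ⊠ idm Y.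
Proof. by rewrite -lu_tensor -compA asK compm1. Qed.

Lemma ru_tensor_asI X Y : ru (X ⊗ Y) ∘ asI X Y 𝟙 = idm X ⊠ ru Y.
Proof. by rewrite -ru_tensor -compA asIK compm1. Qed.

Lemma asI_luI X Y : asI 𝟙 X Y ∘ luI (X ⊗ Y) = luI X ⊠ idm Y.
Proof.
rewrite -[RHS]compm1 -(luIK (X ⊗ Y)) -lu_tensor -!compA.
by rewrite (reassoc (esym (tmorMl _ _ _))) luK tmor1 comp1m.
Qed.

(** Tensored with [𝟙], the claim becomes [lu (𝟙 ⊗ 𝟙) = idm 𝟙 ⊠ lu 𝟙], which is naturality of [lu] at
    [lu 𝟙], cancelled against [lu 𝟙]. *)
Lemma lu1E : lu (𝟙 : C) = ru 𝟙.
Proof.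
apply: tmor1_injr; rewrite -triangle -lu_tensor_as; congr (_ ∘ _).
apply: (split_mono_mono (luK 𝟙)); exact/esym/lu_nat.
Qed.

Lemma triangleI X Y : asI X 𝟙 Y ∘ (idm X ⊠ luI Y) = ruI X ⊠ idm Y.
Proof.
apply: (split_mono_mono (f := ru X ⊠ idm Y) (r := ruI X ⊠ idm Y)).
  by rewrite -tmorMl ruK tmor1.
rewrite -[RHS]tmorMl ruIK tmor1 -triangle -compA (reassoc (asIK _ _ _)) comp1m.
by rewrite -tmorMr luIK tmor1.
Qed.

Section Transpose.
Variables (X Xs : C) (ev : Xs ⊗ X ⟶ 𝟙) (coev : 𝟙 ⟶ X ⊗ Xs).

(** The duality bijection from Hom(W, X ⊗ B) to Hom(Xs ⊗ W, B), with inverse [transposeI]; each of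
    the two cancellations uses one zigzag equation. *)
Definition transpose W B (g : W ⟶ X ⊗ B) : Xs ⊗ W ⟶ B :=
  lu B ∘ (ev ⊠ idm B) ∘ asI Xs X B ∘ (idm Xs ⊠ g).

Definition transposeI W B (h : Xs ⊗ W ⟶ B) : W ⟶ X ⊗ B :=
  (idm X ⊠ h) ∘ as_ X Xs W ∘ (coev ⊠ idm W) ∘ luI W.

Lemma transposeK W B : zigzag ev coev -> cancel (@transpose W B) (@transposeI W B).
Proof.
move=> zz g; rewrite /transpose /transposeI !tmorMr -!compA.
rewrite (reassoc (esym (as_nat _ _ _))) tmor1 -!compA.
rewrite (reassoc (esym (tmor_swap _ _))) -!compA luI_nat.
(* The pentagon, solved for the two associators that separate [ev] from [coev]. *)
have pent : (idm X ⊠ asI Xs X B) ∘ as_ X Xs (X ⊗ B) =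
    as_ X (Xs ⊗ X) B ∘ (as_ X Xs X ⊠ idm B) ∘ asI (X ⊗ Xs) X B.
  rewrite -[LHS]compm1 -(asIK (X ⊗ Xs)) -compA (reassoc (pentagon _ _ _ _)).
  by rewrite -!compA (reassoc (esym (tmorMr _ _ _))) asK tmor1 comp1m.
rewrite (reassoc pent) -!compA.
rewrite (reassoc (esym (as_nat _ _ _))) -!compA (reassoc (triangle _ _)).
rewrite -[idm (X ⊗ B)]tmor1 (reassoc (asI_nat _ _ _)) -!compA.
rewrite (reassoc (asI_luI _ _)) !compA -!tmorMl.
by rewrite (zz : _ = _) tmor1 comp1m.
Qed.

Lemma transposeIK W B : zagzig ev coev -> cancel (@transposeI W B) (@transpose W B).
Proof.
move=> zz h; rewrite /transpose /transposeI !tmorMr -!compA.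
rewrite (reassoc (asI_nat _ _ _)) tmor1 -!compA.
rewrite (reassoc (tmor_swap _ _)) -!compA (reassoc (lu_nat _)) -!compA.
have pent : asI Xs X (Xs ⊗ W) ∘ (idm Xs ⊠ as_ X Xs W) =
    as_ (Xs ⊗ X) Xs W ∘ (asI Xs X Xs ⊠ idm W) ∘ asI Xs (X ⊗ Xs) W.
  apply: (split_mono_mono (asK Xs X (Xs ⊗ W))).
  rewrite [LHS]compA asIK comp1m -!compA (reassoc (pentagon _ _ _ _)) -!compA.
  rewrite (reassoc (esym (tmorMl _ _ _))) asIK tmor1 comp1m.
  by rewrite asIK compm1.
rewrite (reassoc pent) -!compA -[idm (Xs ⊗ W)]tmor1.
rewrite (reassoc (esym (as_nat _ _ _))) -!compA (reassoc (lu_tensor_as _ _)).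
rewrite (reassoc (asI_nat _ _ _)) -!compA triangleI.
rewrite -!tmorMl !compA (zz : _ = _) tmor1.
by rewrite compm1.
Qed.

End Transpose.

End CoherenceMirror.

(** * Projections of F(X ⊗ A) and F(A ⊗ X) to FX *)

(* Locked, as rewriting with associativity would otherwise see through them. *)
HB.lock Definition rproj (k : fieldType) (C D : moncat k) (F : tfunctor C D)
    (A : C) (e : F A ⟶ 𝟙) (X : C) : F (X ⊗ A) ⟶ F X :=
  ru (F X) ∘ (idm (F X) ⊠ e) ∘ muI F X A.

HB.lock Definition lproj (k : fieldType) (C D : moncat k) (F : tfunctor C D)
    (A : C) (e : F A ⟶ 𝟙) (X : C) : F (A ⊗ X) ⟶ F X :=
  lu (F X) ∘ (e ⊠ idm (F X)) ∘ muI F A X.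

Section Projection.
Variables (k : fieldType) (C D : moncat k) (F : tfunctor C D).
Variables (A : C) (e : F A ⟶ 𝟙).
Implicit Types X Y W : C.

Local Notation projr := (rproj e).
Local Notation projl := (lproj e).

Lemma projr_mu X : projr X ∘ mu F X A = ru (F X) ∘ (idm (F X) ⊠ e).
Proof. by rewrite rproj.unlock -compA muK compm1. Qed.

Lemma projr_nat X Y (f : X ⟶ Y) :
  projr Y ∘ fmor F (f ⊠ idm A) = fmor F f ∘ projr X.
Proof.
rewrite rproj.unlock -!compA -muI_nat fmor1 (reassoc (esym (tmor_swap _ _))) -!compA.
by rewrite (reassoc (ru_nat _)) -!compA.
Qed.

Lemma projr_ext W X (h : W ⟶ A) :
  projr X ∘ fmor F (idm X ⊠ h) =
  ru (F X) ∘ (idm (F X) ⊠ (e ∘ fmor F h)) ∘ muI F X W.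
Proof. by rewrite rproj.unlock -!compA -muI_nat fmor1 tmorMr -!compA. Qed.

Lemma projr_tensor X Y :
  projr (X ⊗ Y) ∘ fmor F (asI X Y A) =
  mu F X Y ∘ (idm (F X) ⊠ projr Y) ∘ muI F X (Y ⊗ A).
Proof.
have -> : projr (X ⊗ Y) =
    mu F X Y ∘ ru (F X ⊗ F Y) ∘ (idm _ ⊠ e) ∘ (muI F X Y ⊠ idm _) ∘ muI F _ A.
  rewrite rproj.unlock -!compA (reassoc (esym (tmor_swap (muI F X Y) e))) -!compA.
  rewrite (reassoc (ru_nat _)) -!compA.
  by rewrite (reassoc (muIK F _ _)) comp1m.
rewrite -!compA -muI_asI rproj.unlock !tmorMr -!compA -[idm (F X ⊗ F Y)]tmor1.
rewrite (reassoc (esym (asI_nat _ _ _))) -!compA.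
by rewrite (reassoc (ru_tensor_asI _ _)).
Qed.

(** The triangle axiom lets the middle factor of X ⊗ A ⊗ Y be discarded towards either side. This is
    the central step of the hexagon for the half-braiding. *)
Lemma proj_mid X Y :
  mu F X Y ∘ (idm (F X) ⊠ projl Y) ∘ muI F X (A ⊗ Y) ∘ fmor F (as_ X A Y) =
  mu F X Y ∘ (projr X ⊠ idm (F Y)) ∘ muI F (X ⊗ A) Y.
Proof.
rewrite lproj.unlock rproj.unlock !tmorMr !tmorMl -!compA -muI_as.
rewrite (reassoc (esym (as_nat _ _ _))) -!compA.
by rewrite (reassoc (triangle _ _)).
Qed.

Lemma projr_unit : epsI F ∘ projr 𝟙 = e ∘ fmor F (lu A).
Proof.
rewrite rproj.unlock !compA -ru_nat -!compA (reassoc (tmor_swap _ _)) -!compA.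
rewrite -lu1E (reassoc (lu_nat _)) -!compA; congr (_ ∘ _).
rewrite -mu_lu -!compA (reassoc (esym (tmorMl _ _ _))) epsIK tmor1 comp1m.
by rewrite muIK compm1.
Qed.

Section Dual.
Variables (X Xs : C) (ev : Xs ⊗ X ⟶ 𝟙) (coev : 𝟙 ⟶ X ⊗ Xs).
Hypothesis zz : zigzag ev coev.

(** Injectivity is inherited from [e] by transposition: [e] composed with the transpose of [t]
    depends on [t] only through [projr X ∘ fmor F t]. *)
Lemma projr_inj_dual W (f g : W ⟶ X ⊗ A) :
  (forall V (h h' : V ⟶ A), e ∘ fmor F h = e ∘ fmor F h' -> h = h') ->
  projr X ∘ fmor F f = projr X ∘ fmor F g -> f = g.
Proof.
move=> einj E; apply: (can_inj (transposeK zz)); apply: einj.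
suff H (t : W ⟶ X ⊗ A) : e ∘ fmor F (transpose ev t) =
    epsI F ∘ fmor F ev ∘ mu F Xs X ∘ (idm (F Xs) ⊠ (projr X ∘ fmor F t)) ∘
    muI F Xs W by rewrite !H E.
rewrite /transpose !fmorM !compA -projr_unit -!compA.
rewrite (reassoc (projr_nat _)) -!compA (reassoc (projr_tensor _ _)) -!compA.
by rewrite -muI_nat fmor1 tmorMr -!compA.
Qed.

(** The dual pair F Xs, F X turns [f] into a functional on F(Xs ⊗ W); its lift through [e],
    transposed back, is the preimage. *)
Lemma projr_surj_dual W (f : F W ⟶ F X) :
  (forall V (t : F V ⟶ 𝟙), exists h : V ⟶ A, e ∘ fmor F h = t) ->
  exists g : W ⟶ X ⊗ A, projr X ∘ fmor F g = f.
Proof.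
move=> esurj.
have [h hE] := esurj _ (fev F ev ∘ (idm (F Xs) ⊠ f) ∘ muI F Xs W).
exists (transposeI coev h); rewrite /transposeI -!compA fmorM compA projr_ext hE.
rewrite !tmorMr -!compA (fmorM F (as_ _ _ _)).
rewrite (compA (muI F X _)) (reassoc (esym (muI_as F X Xs W))) -!compA -luI_fcoev.
rewrite (reassoc (esym (as_nat _ _ _))) tmor1 -!compA.
rewrite (reassoc (esym (tmor_swap _ _))) -!compA luI_nat.
have := congr1 (fun t => t ∘ f) (fun_zigzag F zz).
by rewrite comp1m /fev !tmorMr -!compA.
Qed.

End Dual.
End Projection.

Section ProjectionMirror.
Variables (k : fieldType) (C D : moncat k) (F : tfunctor C D).
Variables (A : C) (e : F A ⟶ 𝟙).
Implicit Types X Y W : C.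

Local Notation projr := (rproj e).
Local Notation projl := (lproj e).

(** Reduces every left-handed statement below to the right-handed one for the reversed functor. *)
Lemma projl_rev X : projl X = @rproj k _ _ (rev_tfunctor F) A e X.
Proof. by rewrite lproj.unlock rproj.unlock. Qed.

Lemma projl_mu X : projl X ∘ mu F A X = lu (F X) ∘ (e ⊠ idm (F X)).
Proof. by rewrite projl_rev; exact: (@projr_mu k _ _ (rev_tfunctor F)). Qed.

Lemma projl_nat X Y (f : X ⟶ Y) :
  projl Y ∘ fmor F (idm A ⊠ f) = fmor F f ∘ projl X.
Proof. by rewrite !projl_rev; exact: (@projr_nat k _ _ (rev_tfunctor F)). Qed.

Lemma projl_ext W X (h : W ⟶ A) :
  projl X ∘ fmor F (h ⊠ idm X) =
  lu (F X) ∘ ((e ∘ fmor F h) ⊠ idm (F X)) ∘ muI F W X.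
Proof. by rewrite projl_rev; exact: (@projr_ext k _ _ (rev_tfunctor F)). Qed.

Lemma projl_tensor X Y :
  projl (X ⊗ Y) ∘ fmor F (as_ A X Y) =
  mu F X Y ∘ (projl X ⊠ idm (F Y)) ∘ muI F (A ⊗ X) Y.
Proof. by rewrite !projl_rev; exact: (@projr_tensor k _ _ (rev_tfunctor F)). Qed.

Section Dual.
Variables (X Xs : C) (ev : X ⊗ Xs ⟶ 𝟙) (coev : 𝟙 ⟶ Xs ⊗ X).
Hypothesis zz : zagzig ev coev.

Lemma projl_inj_dual W (f g : W ⟶ A ⊗ X) :
  (forall V (h h' : V ⟶ A), e ∘ fmor F h = e ∘ fmor F h' -> h = h') ->
  projl X ∘ fmor F f = projl X ∘ fmor F g -> f = g.
Proof.
rewrite projl_rev => einj.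
exact: (@projr_inj_dual k _ _ (rev_tfunctor F) A e X Xs ev coev zz W f g einj).
Qed.

Lemma projl_surj_dual W (f : F W ⟶ F X) :
  (forall V (t : F V ⟶ 𝟙), exists h : V ⟶ A, e ∘ fmor F h = t) ->
  exists g : W ⟶ A ⊗ X, projl X ∘ fmor F g = f.
Proof.
rewrite projl_rev => esurj.
exact: (@projr_surj_dual k _ _ (rev_tfunctor F) A e X Xs ev coev zz W f esurj).
Qed.

End Dual.
End ProjectionMirror.

(** * The induced central algebra *)

Section CentralAlgebra.
Variables (k : fieldType) (C D : moncat k) (F : tfunctor C D).
Hypothesis rigC : rigid C.
Variables (A : C) (e : F A ⟶ 𝟙).
(** Together with [esurj], this says that the pair (A, e) represents the functor Hom(F -, 𝟙). *)
Hypothesis einj : forall V (h h' : V ⟶ A), e ∘ fmor F h = e ∘ fmor F h' -> h = h'.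
Hypothesis esurj : forall V (t : F V ⟶ 𝟙), exists h : V ⟶ A, e ∘ fmor F h = t.
Implicit Types X Y W : C.

Local Notation projr := (rproj e).
Local Notation projl := (lproj e).

Lemma projr_inj W X (f g : W ⟶ X ⊗ A) :
  projr X ∘ fmor F f = projr X ∘ fmor F g -> f = g.
Proof.
have [[Xs [ev [coev [zz _]]]] _] := rigC X.
exact: (projr_inj_dual zz einj).
Qed.

Lemma projr_surj W X (f : F W ⟶ F X) :
  exists g : W ⟶ X ⊗ A, projr X ∘ fmor F g = f.
Proof.
have [[Xs [ev [coev [zz _]]]] _] := rigC X.
exact: (projr_surj_dual zz f esurj).
Qed.

Lemma projl_inj W X (f g : W ⟶ A ⊗ X) :
  projl X ∘ fmor F f = projl X ∘ fmor F g -> f = g.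
Proof.
have [_ [Xs [ev [coev [_ zz]]]]] := rigC X.
exact: (projl_inj_dual zz einj).
Qed.

Lemma projl_surj W X (f : F W ⟶ F X) :
  exists g : W ⟶ A ⊗ X, projl X ∘ fmor F g = f.
Proof.
have [_ [Xs [ev [coev [_ zz]]]]] := rigC X.
exact: (projl_surj_dual zz f esurj).
Qed.

Lemma counit_projl : e ∘ projl A = lu 𝟙 ∘ (e ⊠ e) ∘ muI F A A.
Proof.
rewrite lproj.unlock !compA -lu_nat; congr (_ ∘ _).
by rewrite -!compA -tmorM comp1m compm1.
Qed.

(** Both sides are [e ⊠ e] followed by a unit constraint, and [lu 𝟙 = ru 𝟙]. Commutativity of the
    algebra comes from here. *)
Lemma counit_projr : e ∘ projr A = e ∘ projl A.
Proof.
rewrite counit_projl rproj.unlock !compA -ru_nat lu1E; congr (_ ∘ _).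
by rewrite -!compA -tmorM comp1m compm1.
Qed.

Variables (s : forall X, A ⊗ X ⟶ X ⊗ A) (m : A ⊗ A ⟶ A) (u : 𝟙 ⟶ A).
Hypothesis sE : forall X, projr X ∘ fmor F (s X) = projl X.
Hypothesis mE : e ∘ fmor F m = e ∘ projl A.
Hypothesis uE : e ∘ fmor F u = epsI F.

Let mE' : e ∘ fmor F m = e ∘ projr A.
Proof. by rewrite counit_projr. Qed.

Lemma projr_mul X :
  projr X ∘ fmor F (idm X ⊠ m) = projr X ∘ projr (X ⊗ A) ∘ fmor F (asI X A A).
Proof.
rewrite -compA projr_tensor !compA projr_mu projr_ext mE'.
by rewrite tmorMr !compA.
Qed.

Lemma projl_mul X :
  projl X ∘ fmor F (m ⊠ idm X) = projl X ∘ projl (A ⊗ X) ∘ fmor F (as_ A A X).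
Proof.
rewrite -compA projl_tensor !compA projl_mu projl_ext mE.
by rewrite tmorMl !compA.
Qed.

Lemma projl_projl X :
  projl X ∘ projl (A ⊗ X) =
  projl X ∘ mu F A X ∘ (idm (F A) ⊠ projl X) ∘ muI F A (A ⊗ X).
Proof.
have -> : projl (A ⊗ X) = lu _ ∘ (e ⊠ idm _) ∘ muI F A _ by rewrite lproj.unlock.
rewrite projl_mu !compA -lu_nat; congr (_ ∘ _).
by rewrite -!compA; congr (_ ∘ _); rewrite tmor_swap.
Qed.

Lemma projr_unitmor X : projr X ∘ fmor F (idm X ⊠ u) = fmor F (ru X).
Proof.
rewrite projr_ext uE -mu_ru -!compA (reassoc (esym (tmorMr _ _ _))) epsIK.
by rewrite tmor1 comp1m muIK compm1.
Qed.

Lemma projl_unitmor X : projl X ∘ fmor F (u ⊠ idm X) = fmor F (lu X).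
Proof.
rewrite projl_ext uE -mu_lu -!compA (reassoc (esym (tmorMl _ _ _))) epsIK.
by rewrite tmor1 comp1m muIK compm1.
Qed.

Let braid_in X Y :
  (idm (F X) ⊠ projr Y) ∘ muI F X (Y ⊗ A) ∘ fmor F (idm X ⊠ s Y) =
  (idm (F X) ⊠ projl Y) ∘ muI F X (A ⊗ Y).
Proof. by rewrite -compA -muI_nat fmor1 compA -tmorMr sE. Qed.

Let braid_out X Y :
  (projr X ⊠ idm (F Y)) ∘ muI F (X ⊗ A) Y ∘ fmor F (s X ⊠ idm Y) =
  (projl X ⊠ idm (F Y)) ∘ muI F (A ⊗ X) Y.
Proof. by rewrite -compA -muI_nat fmor1 compA -tmorMl sE. Qed.

(** The inverse of [s X] is the lift of [projr X] through [projl X]. In the hexagon, [A] is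
    discarded successively from the right, the middle and the left of X ⊗ Y. *)
Lemma central_half_braiding : is_half_braiding s.
Proof.
split.
- move=> X; have [t tE] := projl_surj (projr X); exists t; split.
    by apply: projl_inj; rewrite fmorM fmor1 compm1 compA tE sE.
  by apply: projr_inj; rewrite fmorM fmor1 compm1 compA sE tE.
- move=> X Y f; apply: projr_inj; rewrite !fmorM !compA sE projl_nat projr_nat.
  by rewrite -compA sE.
- move=> X Y; apply: projr_inj; rewrite sE !fmorM !compA projr_tensor.
  rewrite -!(compA (mu F X Y)) braid_in !compA proj_mid.
  rewrite -!(compA (mu F X Y)) braid_out !compA -projl_tensor.
  by rewrite -compA -fmorM asIK fmor1 compm1.
Qed.

Lemma central_mul : central_mor (tensor_braiding s s) s m.
Proof.
move=> X; apply: projr_inj; rewrite /tensor_braiding !fmorM !compA sE.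
have K : fmor F (asI X A A) ∘ fmor F (as_ X A A) = idm _.
  by rewrite -fmorM asK fmor1.
rewrite projr_mul projl_mul -(compA _ (fmor F (asI X A A))) K compm1.
rewrite -(compA (projr X)) projr_nat compA sE -(compA _ (projr _)) projr_tensor.
rewrite !compA; congr (_ ∘ _); rewrite projl_projl.
by rewrite -!compA; congr (_ ∘ (_ ∘ _)); rewrite compA braid_in.
Qed.

Lemma central_unitmor : central_mor (@unit_braiding k C) s u.
Proof.
move=> X; apply: projr_inj; rewrite /unit_braiding !fmorM !compA sE projl_unitmor.
by rewrite projr_unitmor -fmorM ruIK fmor1 comp1m.
Qed.

Lemma central_commutative_algebra : is_comm_central_algebra (CentralData s m u).
Proof.
split=> /=.
- exact: central_half_braiding.
- exact: central_mul.
- exact: central_unitmor.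
- apply: einj; rewrite !fmorM !compA mE -compA projl_mul -!(compA e) projl_nat.
  by rewrite !(compA e) mE -!compA.
- by apply: einj; rewrite fmorM compA mE -compA projl_unitmor.
- by apply: einj; rewrite fmorM compA mE' -compA projr_unitmor.
- by apply: einj; rewrite fmorM compA mE' -compA sE counit_projr.
Qed.

End CentralAlgebra.

Lemma minvP (k : fieldType) (C : lincat k) (X Y : C) (f : X ⟶ Y) :
  is_iso f -> minv f ∘ f = idm X /\ f ∘ minv f = idm Y.
Proof. by case=> g gP; rewrite /minv; case: xgetP => [h -> //|/(_ g)[]]. Qed.

Section Induced.
Variables (k : fieldType) (C D : moncat k) (F : tfunctor C D).
Hypothesis rigC : rigid C.
Variable R : right_adjoint F.
Implicit Types X Y W : C.

Local Notation e := (adj_counit R 𝟙).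
Local Notation projr := (rproj e).
Local Notation projl := (lproj e).

Lemma adj_inj W (Y : D) (f g : W ⟶ rob R Y) :
  adj_counit R Y ∘ fmor F f = adj_counit R Y ∘ fmor F g -> f = g.
Proof.
have fE (t : W ⟶ rob R Y) :
    t = rmor R (adj_counit R Y ∘ fmor F t) ∘ adj_unit R W.
  by rewrite rmorM -compA -unit_nat compA adj_trr comp1m.
by move=> E; rewrite (fE f) E -fE.
Qed.

Lemma adj_transE W (Y Z : D) (t : Y ⟶ Z) (f : W ⟶ rob R Y) :
  adj_counit R Z ∘ fmor F (rmor R t ∘ f) = t ∘ (adj_counit R Y ∘ fmor F f).
Proof. by rewrite fmorM compA counit_nat -!compA. Qed.

Lemma adj_unitE W (Y : D) (t : F W ⟶ Y) :
  adj_counit R Y ∘ fmor F (rmor R t ∘ adj_unit R W) = t.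
Proof. by rewrite adj_transE adj_trl compm1. Qed.

Lemma lax_muE (Y Z : D) : adj_counit R (Y ⊗ Z) ∘ fmor F (lax_mu R Y Z) =
  (adj_counit R Y ⊠ adj_counit R Z) ∘ muI F (rob R Y) (rob R Z).
Proof. exact: adj_unitE. Qed.

Lemma ind_rE X : adj_counit R (F X) ∘ fmor F (ind_r R X) = projr X.
Proof.
rewrite /ind_r -compA adj_transE fmorM (compA (adj_counit _ _)) lax_muE.
rewrite -!compA -muI_nat fmor1 rproj.unlock -!compA; congr (_ ∘ _).
by rewrite compA -tmorM compm1 adj_trl.
Qed.

Lemma ind_lE X : adj_counit R (F X) ∘ fmor F (ind_l R X) = projl X.
Proof.
rewrite /ind_l -compA adj_transE fmorM (compA (adj_counit _ _)) lax_muE.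
rewrite -!compA -muI_nat fmor1 lproj.unlock -!compA; congr (_ ∘ _).
by rewrite compA -tmorM compm1 adj_trl.
Qed.

Let esurj V (t : F V ⟶ 𝟙) : exists h : V ⟶ rob R 𝟙, e ∘ fmor F h = t.
Proof. by exists (rmor R t ∘ adj_unit R V); rewrite adj_unitE. Qed.

(** [projr X] and the counit at F X both represent Hom(F -, F X), and by [ind_rE] the map
    [ind_r R X] is the comparison between them. *)
Lemma ind_r_iso X : is_iso (ind_r R X).
Proof.
have [g gE] := projr_surj rigC esurj (adj_counit R (F X)).
exists g; split.
  apply: (projr_inj rigC (e := e)) => [V h h'|]; first exact: adj_inj.
  by rewrite fmorM compA gE ind_rE fmor1 compm1.
by apply: adj_inj; rewrite fmorM compA ind_rE gE fmor1 compm1.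
Qed.

Lemma induced_braidE X :
  projr X ∘ fmor F (cd_braid (induced_central_algebra R) X) = projl X.
Proof.
have [_ K] := minvP (ind_r_iso X).
by rewrite -ind_rE -compA -fmorM compA K comp1m ind_lE.
Qed.

Lemma induced_mulE :
  e ∘ fmor F (cd_mul (induced_central_algebra R)) = e ∘ projl (rob R 𝟙).
Proof. by rewrite /= adj_transE lax_muE counit_projl -!compA. Qed.

Lemma induced_oneE : e ∘ fmor F (cd_one (induced_central_algebra R)) = epsI F.
Proof. by rewrite /= /lax_eps adj_unitE. Qed.

Lemma induced_comm_central_algebra :
  is_comm_central_algebra (induced_central_algebra R).
Proof.
apply: (central_commutative_algebra rigC (e := e)) => //.
- by move=> V h h'; exact: adj_inj.
- exact: induced_braidE.
- exact: induced_mulE.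
- exact: induced_oneE.
Qed.

End Induced.

(** * The algebra map attached to a composite functor *)

Lemma ru_fun (k : fieldType) (C D : moncat k) (F : tfunctor C D)
    (X Z : C) (t : Z ⟶ 𝟙) :
  ru (F X) ∘ (idm (F X) ⊠ (epsI F ∘ fmor F t)) ∘ muI F X Z =
  fmor F (ru X ∘ (idm X ⊠ t)).
Proof.
rewrite tmorMr -mu_ru -!compA (reassoc (esym (tmorMr (F X) _ _))).
rewrite epsIK tmor1 comp1m -[idm (F X)]fmor1 muI_nat (reassoc (muIK _ _ _)) comp1m.
by rewrite fmorM.
Qed.

Lemma lu_fun (k : fieldType) (C D : moncat k) (F : tfunctor C D)
    (X Z : C) (t : Z ⟶ 𝟙) :
  lu (F X) ∘ ((epsI F ∘ fmor F t) ⊠ idm (F X)) ∘ muI F Z X =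
  fmor F (lu X ∘ (t ⊠ idm X)).
Proof. exact: (@ru_fun k _ _ (rev_tfunctor F)). Qed.

Section Subalgebra.
Variables (k : fieldType) (E D C : moncat k).
Variables (F'' : tfunctor E D) (F' : tfunctor D C).
Hypothesis rigE : rigid E.
Local Notation F := (tf_comp F' F'').
Variables (R : right_adjoint F) (R'' : right_adjoint F'').
Hypothesis faith : forall (Y : D) (f : Y ⟶ 𝟙), fmor F' f = 0 -> f = 0.

Local Notation e := (adj_counit R 𝟙).
Local Notation e'' := (adj_counit R'' 𝟙).
Local Notation A := (induced_central_algebra R).
Local Notation A'' := (induced_central_algebra R'').

Let i : cd_ob A'' ⟶ cd_ob A :=
  rmor R (epsI F' ∘ fmor F' e'') ∘ adj_unit R (rob R'' 𝟙).

Let iE : e ∘ fmor F i = epsI F' ∘ fmor F' e''.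
Proof. exact: adj_unitE. Qed.

(** By [iE], the functional behind [i] is the image under F' of one in [D], so [ru_fun] places the
    whole projection in the image of F'. *)
Let rproj_i X : rproj e X ∘ fmor F (idm X ⊠ i) = fmor F' (rproj e'' X).
Proof. by rewrite projr_ext iE [in LHS]/= compA ru_fun -fmorM rproj.unlock. Qed.

Let lproj_i X : lproj e X ∘ fmor F (i ⊠ idm X) = fmor F' (lproj e'' X).
Proof. by rewrite projl_ext iE [in LHS]/= compA lu_fun -fmorM lproj.unlock. Qed.

Lemma induced_central_subalgebra : is_central_subalgebra A'' A.
Proof.
have oneE := induced_oneE R; have mulE := induced_mulE R.
exists i; split.
(* If [i ∘ g] vanishes, F' kills the functional e'' ∘ F''(g); by [faith] that functional is zero,
   and so is its transpose [g]. *)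
- apply: mono0P => Z g ig; apply: (adj_inj (R := R'')).
  rewrite fmor0 compm0; apply: faith; rewrite fmorM.
  have : e ∘ fmor F (i ∘ g) = 0 by rewrite ig fmor0 compm0.
  rewrite fmorM compA iE -compA => /(congr1 (fun t => eps F' ∘ t)).
  by rewrite compA epsIK comp1m compm0.
- move=> X.
  apply: (projr_inj rigE (e := e)) => [V h h'|]; first exact: adj_inj.
  rewrite [fmor F (_ ∘ cd_braid A'' X)]fmorM [fmor F (cd_braid A X ∘ _)]fmorM.
  rewrite !compA (induced_braidE rigE) rproj_i lproj_i.
  by rewrite -(induced_braidE rigE R'') (fmorM F').
- apply: (adj_inj (R := R)).
  rewrite [fmor F (i ∘ _)]fmorM [fmor F (cd_mul A ∘ _)]fmorM !compA iE mulE.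
  have := congr1 (fun t => epsI F' ∘ fmor F' t) (induced_mulE R'').
  rewrite !(fmorM F') compA => ->; rewrite compA -iE.
  have -> : i ⊠ i = (idm _ ⊠ i) ∘ (i ⊠ idm _) by rewrite -tmorM comp1m compm1.
  rewrite [fmor F (_ ⊠ i ∘ _)]fmorM compA -(compA e (lproj e _)).
  rewrite projl_nat.
  by rewrite compA -(compA _ (lproj e _)) lproj_i.
- apply: (adj_inj (R := R)).
  rewrite [fmor F (i ∘ _)]fmorM compA iE oneE.
  have := congr1 (fun t => epsI F' ∘ fmor F' t) (induced_oneE R'').
  by rewrite !(fmorM F') compA.
Qed.

End Subalgebra.

(** * Dimension functions and the Frobenius-Perron dimension *)

Local Notation hdim X Y := (\dim {: X ⟶ Y}).

(** The images of the injective maps [a i] are in direct sum and span [V], with coordinates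
    [b i]. *)
Lemma dim_biproduct (k : fieldType) (V : vectType k) (I : finType)
    (W : I -> vectType k) (a : forall i, {linear W i -> V})
    (b : forall i, {linear V -> W i}) :
  (forall i, cancel (a i) (b i)) -> (forall i j x, i != j -> b j (a i x) = 0) ->
  (forall v, \sum_i a i (b i v) = v) ->
  \dim {:V} = (\sum_i \dim {: W i})%N.
Proof.
move=> ab ab0 sab; pose U i := limg (linfun (a i)).
have aU i x : a i x \in U i.
  by apply/memv_imgP; exists x; rewrite ?memvf // lfunE.
have dvU : directv (\sum_i U i).
  apply/directv_sum_independent => us Hus s0 i _.
  have /fin_all_exists[w wE] j : exists w, us j = a j w.
    by have /memv_imgP[x _ ->] := Hus j isT; exists x; rewrite lfunE.
  have := congr1 (b i) s0; rewrite linear_sum linear0 (bigD1 i) //= big1.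
    by rewrite addr0 wE ab => ->; rewrite linear0.
  by move=> j ji; rewrite wE ab0.
have -> : {:V}%VS = (\sum_i U i)%VS.
  apply/eqP; rewrite eqEsubv subvf andbT; apply/subvP => v _.
  by rewrite -(sab v); apply: memv_sumr => i _; exact: aU.
rewrite (directvP dvU) /=; apply: eq_bigr => i _.
apply: limg_dim_eq; rewrite capfv; apply/eqP/lker0P => x y.
by rewrite !lfunE => /(congr1 (b i)); rewrite !ab.
Qed.

Section HomDim.
Variables (k : fieldType) (C : lincat k).
Implicit Types X Y Z T : C.

Lemma hdim_sumr (I : finType) (Y : I -> C) X T :
  is_dirsum Y X -> hdim T X = (\sum_j hdim T (Y j))%N.
Proof.
move=> [i [p [H1 H2 H3]]].
apply: (dim_biproduct (a := fun j => @mcomp k C T _ _ (i j))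
          (b := fun j => @mcomp k C T _ _ (p j))) => [j x|j l x ne|v] /=.
- by rewrite compA H1 comp1m.
- by rewrite compA H2 // comp0m.
- under eq_bigr => j _ do rewrite compA.
  by rewrite -comp_suml H3 comp1m.
Qed.

Lemma hdim_suml (I : finType) (Y : I -> C) X T :
  is_dirsum Y X -> hdim X T = (\sum_j hdim (Y j) T)%N.
Proof.
move=> [i [p [H1 H2 H3]]].
apply: (dim_biproduct (a := fun j => @rcomp k C _ _ T (p j))
          (b := fun j => @rcomp k C _ _ T (i j))) => [j x|j l x ne|v];
  rewrite /= /rcomp.
- by rewrite -compA H1 compm1.
- by rewrite -compA H2 1?eq_sym // compm0.
- under eq_bigr => j _ do rewrite -compA.
  by rewrite -comp_sumr H3 compm1.
Qed.

Lemma dirsum_iso X Y : X ≅ Y -> is_dirsum (fun _ : unit => Y) X.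
Proof.
case=> f [g [gf fg]]; exists (fun=> g), (fun=> f); split=> //.
by rewrite big_const card_unit /= addr0.
Qed.

Lemma hdim_isor X Y T : X ≅ Y -> hdim T X = hdim T Y.
Proof. by move=> /dirsum_iso/hdim_sumr ->; rewrite big_const card_unit /= addn0. Qed.

Lemma hdim_isol X Y T : X ≅ Y -> hdim X T = hdim Y T.
Proof. by move=> /dirsum_iso/hdim_suml ->; rewrite big_const card_unit /= addn0. Qed.

Lemma hdim_eq0P X Y : reflect (forall f : X ⟶ Y, f = 0) (hdim X Y == 0%N).
Proof.
rewrite dimv_eq0; apply: (iffP eqP) => [E f|E].
  by apply/eqP; rewrite -memv0 -E memvf.
by apply/eqP; rewrite -subv0; apply/subvP => f _; rewrite (E f) memv0.
Qed.

Lemma hdim_neq0 X Y : hdim X Y != 0%N -> exists f : X ⟶ Y, f <> 0.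
Proof.
by move=> /hdim_eq0P H; apply: contrapT => K; apply: H => f;
   apply: contrapT => f0; apply: K; exists f.
Qed.

Lemma hdim_gt0 X Y (f : X ⟶ Y) : f <> 0 -> (0 < hdim X Y)%N.
Proof. by rewrite lt0n => f0; apply/hdim_eq0P => /(_ f). Qed.

Lemma factor_retract X Y : factor Y X ->
  exists (f : Y ⟶ X) (r : X ⟶ Y), r ∘ f = idm Y.
Proof.
case=> Z [i [p [H1 _ _]]]; exists (i true), (p true); exact: H1 true.
Qed.

(** The family may be empty, so an additive function vanishes on zero objects. *)
Definition additive (d : C -> nat) : Prop :=
  forall (I : finType) (Y : I -> C) X, is_dirsum Y X -> d X = (\sum_i d (Y i))%N.

Lemma additive_iso d X Y : additive d -> X ≅ Y -> d X = d Y.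
Proof. by move=> ad /dirsum_iso/ad ->; rewrite big_const card_unit /= addn0. Qed.

End HomDim.

(** A character of the Grothendieck ring with values in the natural numbers; on a fusion category
    [FPdim_obE] identifies it with the Frobenius-Perron dimension. *)
Definition dimension_function (k : fieldType) (C : moncat k) (d : C -> nat) :=
  [/\ additive d, d 𝟙 = 1%N & forall X Y, d (X ⊗ Y) = (d X * d Y)%N].

Lemma hdim_transpose (k : fieldType) (C : moncat k) (X Xs : C) :
  is_dual Xs X -> forall W B, hdim W (X ⊗ B) = hdim (Xs ⊗ W) B.
Proof.
move=> [ev [coev [zz zz']]] W B.
have linT : linear (fun h : Xs ⊗ W ⟶ B => transposeI coev h).
  by move=> a f g; rewrite /transposeI tmor_linr !comp_linl.
pose Ti : {linear (Xs ⊗ W ⟶ B) -> (W ⟶ X ⊗ B)} :=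
  HB.pack (fun h : Xs ⊗ W ⟶ B => transposeI coev h) (GRing.isLinear.Build _ _ _ _ _ linT).
have linT' : linear (fun h : W ⟶ X ⊗ B => transpose ev h).
  by move=> a f g; rewrite /transpose tmor_linr !comp_linr.
pose T : {linear (W ⟶ X ⊗ B) -> (Xs ⊗ W ⟶ B)} :=
  HB.pack (fun h : W ⟶ X ⊗ B => transpose ev h) (GRing.isLinear.Build _ _ _ _ _ linT').
rewrite (@dim_biproduct k _ unit (fun=> Xs ⊗ W ⟶ B) (fun=> Ti) (fun=> T)).
- by rewrite big_const card_unit /= addn0.
- by move=> _; exact: transposeIK.
- by case; case.
- by move=> v; rewrite big_const card_unit /= addr0; exact: transposeK.
Qed.

Lemma hdim_transpose_rev (k : fieldType) (C : moncat k) (X Xs : C) :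
  is_dual Xs X -> forall W B, hdim W (B ⊗ Xs) = hdim (W ⊗ X) B.
Proof.
move=> [ev [coev [zz zz']]] W B.
by apply: (@hdim_transpose k (rev_moncat C) Xs X); exists ev, coev.
Qed.

Section FusionDim.
Variables (k : fieldType) (C : fusioncat k).
Implicit Types X Y Z T : C.
Local Notation S := (@irr k C).
Local Notation I := (irr_idx C).

Let ssC : semisimple C := fus_semisimple (fusP C).

Lemma irr_simple (i : I) : simple (S i).
Proof. by case: (irrP C). Qed.

Lemma simple_irr X : simple X -> exists i : I, X ≅ S i.
Proof. by case: (irrP C) => _ _; exact. Qed.

Lemma simple_retract X Z (f : X ⟶ Z) : simple X -> f <> 0 ->
  exists r : Z ⟶ X, r ∘ f = idm X.
Proof.
move=> sX f0; have [n [c [i [p [_ _ H3]]]]] := irr_decomp ssC (irrP C) Z.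
have [j pf0] := dirsum_in_neq0 H3 f0.
have [g [gK _]] := schur ssC.1 sX (irr_simple (c j)) pf0.
by exists (g ∘ p j); rewrite -compA.
Qed.

Lemma simple_section X Z (f : Z ⟶ X) : simple X -> f <> 0 ->
  exists r : X ⟶ Z, f ∘ r = idm X.
Proof.
move=> sX f0; have [n [c [i [p [_ _ H3]]]]] := irr_decomp ssC (irrP C) Z.
have [j pf0] := dirsum_out_neq0 H3 f0.
have [g [_ gK]] := schur ssC.1 (irr_simple (c j)) sX pf0.
by exists (i j ∘ g); rewrite compA.
Qed.

Lemma hdim_simple X : simple X -> hdim X X = 1%N.
Proof.
move=> sX; have -> : {: X ⟶ X}%VS = <[idm X]>%VS.
  apply/eqP; rewrite eqEsubv subvf andbT; apply/subvP => f _.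
  by have [a ->] := fus_split (fusP C) sX f; rewrite memvZ // memv_line.
by rewrite dim_vline; case: eqP sX => // E [].
Qed.

Lemma hdim_irr (i j : I) : hdim (S i) (S j) = (i == j).
Proof.
have [->|ne] := eqVneq i j; first exact/hdim_simple/irr_simple.
apply/eqP/hdim_eq0P => f; apply: (irr_hom ssC (irrP C)).
exact/eqP.
Qed.

Lemma hdim_irrC (i : I) X : hdim (S i) X = hdim X (S i).
Proof.
have [n [c dX]] := irr_decomp ssC (irrP C) X.
rewrite (hdim_sumr _ dX) (hdim_suml _ dX); apply: eq_bigr => j _.
by rewrite !hdim_irr eq_sym.
Qed.

Lemma additive_irr (d : C -> nat) X : additive d ->
  d X = (\sum_i hdim (S i) X * d (S i))%N.
Proof.
move=> ad; have [n [c dX]] := irr_decomp ssC (irrP C) X.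
rewrite (ad _ _ _ dX).
under [RHS]eq_bigr => i _ do rewrite (hdim_sumr _ dX) big_distrl.
rewrite /= exchange_big /=; apply: eq_bigr => j _.
rewrite (bigD1 (c j)) //= hdim_irr eqxx mul1n big1 ?addn0 // => i /negbTE ne.
by rewrite hdim_irr ne mul0n.
Qed.

Lemma neq0_irr X : idm X <> 0 -> exists i : I, hdim (S i) X != 0%N.
Proof.
move=> X0; have [n [c dX]] := irr_decomp ssC (irrP C) X.
case: n c dX => [|n] c [i [p [H1 _ H3]]].
  by case: X0; rewrite -H3 big_ord0.
exists (c ord0); rewrite -lt0n; apply: (hdim_gt0 (f := i ord0)) => E.
by case: (irr_simple (c ord0)) => + _; apply; rewrite -H1 E compm0.
Qed.

Lemma unit_factorP X : factor 𝟙 X <-> hdim X 𝟙 != 0%N.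
Proof.
have s1 := fus_unit (fusP C); split.
  move=> /factor_retract[f [r rf]]; rewrite -lt0n; apply: (hdim_gt0 (f := r)) => r0.
  by case: s1 => + _; apply; rewrite -rf r0 comp0m.
by move=> /hdim_neq0[f /(simple_section s1)[r fr]]; exact: (retract_factor ssC.1 fr).
Qed.

(** The zigzag equations force [coev] to be nonzero, and a nonzero map out of the simple unit
    splits. *)
Lemma dual_factor X Xs : is_dual Xs X -> idm X <> 0 \/ idm Xs <> 0 ->
  factor 𝟙 (X ⊗ Xs).
Proof.
move=> [ev [coev [zz zz']]] X0.
have /(simple_retract (fus_unit (fusP C)))[r rc] : coev <> 0.
  move=> E; rewrite E in zz zz'; case: X0; apply.
    by rewrite -(zz : _ = _) tmor0l compm0 comp0m.
  by rewrite -(zz' : _ = _) tmor0r compm0 comp0m.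
exact: (retract_factor ssC.1 rc).
Qed.

Lemma additive_factor (d : C -> nat) X Y : additive d -> factor Y X ->
  (d Y <= d X)%N.
Proof. by move=> ad [Z dX]; rewrite (ad _ _ _ dX) big_bool leq_addr. Qed.

Lemma dimension_dual (d : C -> nat) X Xs : dimension_function d -> is_dual Xs X ->
  idm X <> 0 \/ idm Xs <> 0 -> (0 < d X * d Xs)%N.
Proof.
move=> [ad d1 dM] dX X0; rewrite -dM -d1.
exact: additive_factor ad (dual_factor dX X0).
Qed.

Lemma dimension_gt0 (d : C -> nat) X : dimension_function d -> idm X <> 0 ->
  (0 < d X)%N.
Proof.
move=> dd X0; have [[Xs dX] _] := fus_rigid (fusP C) X.
by have := dimension_dual dd dX (or_introl X0); rewrite muln_gt0 => /andP[].
Qed.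

Lemma dimension_neq0 (d : C -> nat) X : dimension_function d -> (0 < d X)%N ->
  idm X <> 0.
Proof.
(* An object with zero identity is the biproduct of the empty family. *)
pose Y (v : void) : C := match v with end.
move=> [ad _ _] + X0; have dX : is_dirsum Y X.
  exists (fun v : void => match v with end), (fun v : void => match v with end).
  by split=> [[]|[]|]; rewrite big_pred0 ?X0 // => [[]].
by rewrite (ad _ _ _ dX) big_pred0 // => [[]].
Qed.

Variable R : realType.

(** The dimensions of the simple objects form a positive column eigenvector [v] for d(X). Pairing
    [v] with the absolute values of a row eigenvector for x ≥ 0 gives x ≤ d(X), so the supremum is
    attained at d(X). *)
Lemma FPdim_obE (d : C -> nat) X : dimension_function d ->
  FPdim_ob R X = (d X)%:R.
Proof.
move=> dd; have [ad d1 dM] := dd; rewrite /FPdim_ob.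
pose v : 'cV[R]_#|I| := \col_j (d (S (enum_val j)))%:R.
have v0 j : 0 < v j 0.
  by rewrite mxE ltr0n; apply: dimension_gt0 => //; case: (irr_simple (enum_val j)).
have Mv : lmul_mx R X *m v = (d X)%:R *: v.
  apply/matrixP => j l; rewrite !mxE (ord1 l) -natrM -dM (additive_irr _ ad).
  rewrite natr_sum (reindex (@enum_val _ I)) /=; last exact/onW_bij/enum_val_bij.
  by apply: eq_bigr => i _; rewrite !mxE natrM.
set A := (X in sup X).
have ub x : A x -> x <= (d X)%:R.
  move=> [x0 /eigenvalueP[u uM u0]].
  pose s := \sum_j `|u 0 j| * v j 0.
  have s0 : 0 < s.
    have [j uj] : exists j, u 0 j != 0.
      apply/existsP; apply: contraNT u0; rewrite negb_exists => /forallP H.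
      by apply/eqP/rowP => j; rewrite mxE; apply/eqP; move: (H j); rewrite negbK.
    rewrite /s (bigD1 j) //= ltr_pwDl ?mulr_gt0 ?normr_gt0 //.
    by apply: sumr_ge0 => l _; rewrite mulr_ge0 // ltW.
  rewrite -(ler_pM2r s0) /s !big_distrr /=.
  have le1 j : x * (`|u 0 j| * v j 0) <=
      \sum_l `|u 0 l| * (lmul_mx R X l j * v j 0).
    rewrite mulrA; under eq_bigr => l _ do rewrite mulrA.
    rewrite -mulr_suml ler_pM2r // -[x in x * _]ger0_norm // -normrM.
    have -> : x * u 0 j = (u *m lmul_mx R X) 0 j by rewrite uM mxE.
    rewrite mxE; apply: le_trans (ler_norm_sum _ _ _) _.
    by apply: ler_sum => l _; rewrite normrM [`|lmul_mx _ _ _ _|]ger0_norm // mxE ler0n.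
  apply: le_trans (ler_sum _ (fun j _ => le1 j)) _.
  rewrite exchange_big /=; apply: ler_sum => l _.
  rewrite -mulr_sumr mulrCA; apply: ler_wpM2l => //.
  by have := congr1 (fun w : 'cV_ _ => w l 0) Mv; rewrite !mxE => ->.
(* [eigenvalue] concerns row vectors while [v] is a column; singularity of the shifted matrix links
   the two. *)
have Ad : A (d X)%:R.
  split; first exact: ler0n.
  rewrite /eigenvalue /eigenspace kermx_eq0 row_free_unit; apply/negP => uM.
  have : (lmul_mx R X - (d X)%:R%:M) *m v = 0.
    by rewrite mulmxBl Mv mul_scalar_mx subrr.
  move=> /(congr1 (mulmx (invmx (lmul_mx R X - (d X)%:R%:M)))).
  rewrite mulKmx // mulmx0 => E.
  have [i _] := simple_irr (fus_unit (fusP C)).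
  by have := v0 (enum_rank i); rewrite E mxE ltxx.
apply/eqP; rewrite eq_le; apply/andP; split.
  by apply: ge_sup => //; exists (d X)%:R.
by apply: ub_le_sup => //; exists (d X)%:R.
Qed.

Lemma FPdimE (d : C -> nat) : dimension_function d ->
  FPdim R C = (\sum_i d (S i) ^ 2)%:R.
Proof.
by move=> dd; rewrite natr_sum; apply: eq_bigr => i _; rewrite (FPdim_obE _ dd) natrX.
Qed.

End FusionDim.

Lemma additive_hdiml (k : fieldType) (C D : moncat k) (G : tfunctor C D) (T : D) :
  additive (fun X : C => hdim (G X) T).
Proof. by move=> I Y X /(fmor_dirsum G)/hdim_suml ->. Qed.

Lemma tfunctor_iso (k : fieldType) (C D : moncat k) (G : tfunctor C D) (X Y : C) :
  X ≅ Y -> G X ≅ G Y.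
Proof.
by case=> f [g [gf fg]]; exists (fmor G f), (fmor G g); rewrite -!fmorM gf fg !fmor1.
Qed.

Lemma tfunctor_unit (k : fieldType) (C D : moncat k) (G : tfunctor C D) :
  𝟙 ≅ G 𝟙.
Proof. by exists (eps G), (epsI G); rewrite epsK epsIK. Qed.

Lemma tfunctor_tensor (k : fieldType) (C D : moncat k) (G : tfunctor C D) (X Y : C) :
  G X ⊗ G Y ≅ G (X ⊗ Y).
Proof. by exists (mu G X Y), (muI G X Y); rewrite muK muIK. Qed.

Lemma dimension_pullback (k : fieldType) (C D : moncat k) (G : tfunctor C D)
    (d : D -> nat) : dimension_function d -> dimension_function (fun X => d (G X)).
Proof.
move=> [ad d1 dM]; split=> [I Y X /(fmor_dirsum G)/ad //| |X Y].
  by rewrite -(additive_iso ad (tfunctor_unit G)).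
by rewrite -(additive_iso ad (tfunctor_tensor G X Y)).
Qed.

Lemma tfunctor_dual (k : fieldType) (C D : moncat k) (G : tfunctor C D) (X Xs : C) :
  is_dual Xs X -> is_dual (G Xs) (G X).
Proof.
move=> [ev [coev [zz zz']]]; exists (fev G ev), (fcoev G coev).
by split; [exact: fun_zigzag | exact: fun_zagzig].
Qed.

(** * Dominant functors and the ratio of dimensions *)

Section Index.
Variables (k : fieldType) (C D : fusioncat k) (G : tfunctor C D).
Variable d : D -> nat.
Hypothesis dd : dimension_function d.
Implicit Types X : C.
Local Notation S := (@irr k C).
Local Notation T := (@irr k D).

(* [regmult Y] is the multiplicity of [Y] in the image of the regular object
   \sum_i d(S_i) S_i. *)
Definition regmult (Y : D) : nat := (\sum_i d (G (S i)) * hdim (G (S i)) Y)%N.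

Lemma regmult_additive : additive regmult.
Proof.
move=> I Y X dX; rewrite /regmult.
under eq_bigr => i _ do rewrite (hdim_sumr _ dX) big_distrr.
by rewrite exchange_big.
Qed.

(** By rigidity Hom(G S_i, GX ⊗ Y) becomes Hom(G(Xs ⊗ S_i), Y). Expanding Xs ⊗ S_i into simple
    objects and summing over [i] first reassembles d(G(X ⊗ S_l)). *)
Lemma regmult_tensor X Y : regmult (G X ⊗ Y) = (d (G X) * regmult Y)%N.
Proof.
have [ad _ dM] := dimension_pullback G dd.
have [[Xs dX] _] := fus_rigid (fusP C) X.
have E i : hdim (G (S i)) (G X ⊗ Y) =
    (\sum_l hdim (S i) (X ⊗ S l) * hdim (G (S l)) Y)%N.
  rewrite (hdim_transpose (tfunctor_dual G dX)) (hdim_isol _ (tfunctor_tensor _ _ _)).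
  rewrite (additive_irr _ (additive_hdiml G Y)); apply: eq_bigr => l _.
  by rewrite hdim_irrC -(hdim_transpose dX).
rewrite /regmult; under eq_bigr => i _ do rewrite E big_distrr.
rewrite exchange_big big_distrr /=; apply: eq_bigr => l _.
under eq_bigr => i _ do rewrite mulnCA mulnA.
by rewrite -big_distrl /= -(additive_irr _ ad) dM mulnA.
Qed.

Hypothesis domG : dominant G.

(** T1 ⊗ sT has positive dimension, hence a simple constituent, which occurs in some G X by
    dominance. Moving sT across the duality gives a nonzero map from T1 to GX ⊗ T2. *)
Lemma dominant_link (T1 T2 : D) : simple T1 -> simple T2 ->
  exists X, hdim T1 (G X ⊗ T2) != 0%N.
Proof.
move=> s1 s2; have [_ [sT dT]] := fus_rigid (fusP D) T2.
have : (0 < d (T1 ⊗ sT))%N.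
  have [_ _ ->] := dd; rewrite muln_gt0 (dimension_gt0 dd) /=; last by case: s1.
  have := dimension_dual dd dT (or_intror s2.1).
  by rewrite muln_gt0 => /andP[].
move=> /(dimension_neq0 dd)/neq0_irr[u hu].
have [X [_ XT]] := domG (irr_simple u).
exists X; rewrite (hdim_transpose_rev dT) -lt0n.
have adh : additive (fun Z : D => hdim (T1 ⊗ sT) Z) by move=> I Y Z /hdim_sumr ->.
by apply: leq_trans (additive_factor adh XT); rewrite -hdim_irrC lt0n.
Qed.

Lemma regmult_proportional (j : irr_idx D) : regmult (T j) = (regmult 𝟙 * d (T j))%N.
Proof.
have [ad d1 dM] := dd; have Td0 i : (0 < d (T i))%N.
  by apply: dimension_gt0 => //; case: (irr_simple i).
(* Rational ratios serve only to choose the minimizer; [le0] clears the denominators. *)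
pose q i : rat := (regmult (T i))%:R / (d (T i))%:R.
have [j0 _ j0min] := @Order.TotalTheory.arg_minP _ rat _ j predT q isT.
have le0 i : (regmult (T j0) * d (T i) <= regmult (T i) * d (T j0))%N.
  have := j0min i isT; rewrite /q ler_pdivrMr ?ltr0n // mulrAC ler_pdivlMr ?ltr0n //.
  by rewrite -!natrM ler_nat.
(* By [regmult_tensor], the inequalities [le0], summed with multiplicity over the constituents of GX
   ⊗ T j0, add up to an equality; so each constituent that occurs gives an equality. *)
have eq0 i : (regmult (T j0) * d (T i) = regmult (T i) * d (T j0))%N.
  have [X XT] := dominant_link (irr_simple i) (irr_simple j0).
  have := regmult_tensor X (T j0).
  rewrite (additive_irr (G X ⊗ T j0) regmult_additive) => /(congr1 (fun n => n * d (T j0)))%N.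
  rewrite mulnAC -dM (additive_irr (G X ⊗ T j0) ad) [RHS]mulnC big_distrl big_distrr /=.
  pose a l := (regmult (T j0) * (hdim (T l) (G X ⊗ T j0) * d (T l)))%N.
  pose b l := (hdim (T l) (G X ⊗ T j0) * regmult (T l) * d (T j0))%N.
  have lif l : (a l <= b l ?= iff (a l == b l))%N.
    by split=> //; rewrite /a /b mulnCA -mulnA leq_mul2l le0 orbT.
  move=> E; have := leqif_sum (fun l (_ : predT l) => lif l).
  rewrite -/(\sum_i a i)%N in E; rewrite E => -[_]; rewrite eqxx.
  move=> /esym/forallP/(_ i) /=.
  by rewrite /a /b mulnCA -mulnA eqn_mul2l (negbTE XT) /= => /eqP.
(* The constant of proportionality is read off at the unit object, where [d] is 1. *)
have [i1 e1] := simple_irr (fus_unit (fusP D)).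
have := eq0 j; have := eq0 i1.
rewrite -(additive_iso ad e1) -(additive_iso regmult_additive e1) d1 muln1 => ->.
by rewrite mulnAC => /eqP; rewrite eqn_pmul2r // => /eqP.
Qed.

Lemma dominant_sum_squares :
  (\sum_i d (G (S i)) ^ 2 = regmult 𝟙 * \sum_j d (T j) ^ 2)%N.
Proof.
have [ad _ _] := dd; rewrite big_distrr /=.
under [RHS]eq_bigr => j _ do rewrite expnSr expn1 mulnA -regmult_proportional /regmult big_distrl.
rewrite /= exchange_big; apply: eq_bigr => i _ /=.
rewrite expnSr expn1 [X in (_ * X)%N](additive_irr _ ad) big_distrr /=.
by apply: eq_bigr => j _; rewrite hdim_irrC mulnA.
Qed.

Lemma trivial_dim X : trivial (G X) -> d (G X) = hdim (G X) 𝟙.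
Proof.
have [ad d1 _] := dd; move=> [n dX]; rewrite (ad _ _ _ dX) (hdim_suml _ dX).
by apply: eq_bigr => j _; rewrite d1 hdim_simple //; exact: fus_unit (fusP D).
Qed.

(** By [trivial_dim] the left side is the part of [regmult 𝟙] indexed by the kernel. As every d(G
    S_i) is positive, the other summands all vanish exactly when [G] is normal. *)
Lemma normal_regmult : normal G <->
  (\sum_(i | `[< in_ker G (S i) >]) d (G (S i)) ^ 2)%N = regmult 𝟙.
Proof.
have [ad d1 _] := dd.
pose inK i := `[< in_ker G (S i) >].
have -> : regmult 𝟙 = (\sum_(i | inK i) d (G (S i)) ^ 2 +
    \sum_(i | ~~ inK i) d (G (S i)) * hdim (G (S i)) 𝟙)%N.
  rewrite /regmult (bigID inK) /=; congr (_ + _)%N.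
  by apply: eq_bigr => i /asboolP /trivial_dim <-; rewrite expnSr expn1.
rewrite -[X in X = _]addn0; split=> [nG|/addnI/esym/eqP].
  congr (_ + _)%N; apply/esym/eqP; rewrite sum_nat_eq0; apply/forallP => i.
  apply/implyP => /asboolPn ti; rewrite muln_eq0; apply/orP; right.
  by apply/negPn/negP => /unit_factorP /(nG _ (irr_simple i)).
rewrite sum_nat_eq0 => /forallP H X /simple_irr[i Xi].
have GX : G (S i) ≅ G X := tfunctor_iso G (isomorphic_sym Xi).
move=> /unit_factorP; rewrite -(hdim_isol _ GX) => h1.
apply: trivial_iso GX _; apply: contrapT => /asboolPn ti.
have := H i; rewrite ti muln_eq0 (negbTE h1) orbF => /eqP dS0.
have := dimension_gt0 (dimension_pullback G dd) (irr_simple i).1.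
by rewrite dS0.
Qed.

End Index.

(** * Kernel of a tensor functor *)

Section Kernel.
Variables (k : fieldType) (C D : fusioncat k) (F : tfunctor C D).
Implicit Types X Y : Ker F.

Let s1 : simple (𝟙 : D) := fus_unit (fusP D).

Lemma ker_simple X : simple X <-> simple (ker_ob X).
Proof.
apply: full_simple => Y Z f r rf tY.
apply: (trivial_retract (fus_semisimple (fusP D)) s1 (f := fmor F f)
          (r := fmor F r)) tY.
by rewrite -fmorM rf fmor1.
Qed.

Lemma ker_factor X Y : factor (ker_ob X) (ker_ob Y) -> factor X Y.
Proof.
move=> /factor_retract[f [r rf]].
exact: (@retract_factor k (Ker F) (fus_semisimple (fusP (Ker F))).1 Y X f r rf).
Qed.

(** F X is a sum of copies of [𝟙] and Hom(𝟙, -) counts them, whence multiplicativity. *)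
Lemma ker_dimension : dimension_function (fun X => hdim 𝟙 (F (ker_ob X))).
Proof.
have h1 : hdim 𝟙 (𝟙 : D) = 1%N := hdim_simple s1.
split.
- move=> I Y X dX.
  have dX' : @is_dirsum k C I (fun i => ker_ob (Y i)) (ker_ob X) := dX.
  by rewrite (hdim_sumr _ (fmor_dirsum F dX')).
- by rewrite -(hdim_isor _ (tfunctor_unit F)).
- move=> X Y; rewrite -(hdim_isor _ (tfunctor_tensor F (ker_ob X) (ker_ob Y))).
  have [n tX] := svalP X; have [m tY] := svalP Y.
  have E : 𝟙 ⊗ 𝟙 ≅ (𝟙 : D) by exists (lu 𝟙), (luI 𝟙); rewrite luK luIK.
  rewrite (hdim_sumr _ tX) (hdim_sumr _ tY) (hdim_sumr _ (dirsum_tensor tX tY)).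
  under eq_bigr => u _ do rewrite (hdim_isor _ E) h1.
  under [X in (X * _)%N]eq_bigr => u _ do rewrite h1.
  under [X in (_ * X)%N]eq_bigr => u _ do rewrite h1.
  by rewrite !sum1_card card_prod.
Qed.

Lemma ker_unit_factor X : simple X -> factor 𝟙 (F (ker_ob X)).
Proof.
move=> sX; have := dimension_gt0 ker_dimension sX.1.
rewrite lt0n => /hdim_neq0[f /(simple_retract s1)[r rf]].
exact: (retract_factor (fus_semisimple (fusP D)).1 rf).
Qed.

End Kernel.

(** A nonzero map to the simple unit has a section, so F sends it to a split epimorphism onto F 𝟙 ≅
    𝟙, which is not zero. *)
Lemma unit_functional_faithful (k : fieldType) (C D : fusioncat k)
    (F : tfunctor C D) (X : C) (f : X ⟶ 𝟙) : fmor F f = 0 -> f = 0.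
Proof.
move=> Ff; apply: contrapT => /(simple_section (fus_unit (fusP C)))[r fr].
case: (fus_unit (fusP D)) => + _; apply.
by rewrite -(epsK F) -(comp1m (eps F)) -fmor1 -fr fmorM Ff comp0m comp0m compm0.
Qed.

Lemma factor_tfunctor (k : fieldType) (C D : moncat k) (F : tfunctor C D) (X Y : C) :
  factor Y X -> factor (F Y) (F X).
Proof.
move=> [Z /(fmor_dirsum F) dX]; exists (F Z).
apply: dirsum_isoY dX; case; exact: isomorphic_refl.
Qed.

Lemma factor_unit_trans (k : fieldType) (C : fusioncat k) (X Y : C) :
  factor 𝟙 Y -> factor Y X -> factor 𝟙 X.
Proof.
move=> /factor_retract[f [r rf]] /factor_retract[g [t tg]].
apply: (retract_factor (fus_semisimple (fusP C)).1 (f := g ∘ f) (r := r ∘ t)).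
by rewrite -compA (compA t) tg comp1m.
Qed.

(** The representatives [irr] of the two categories are chosen independently, so the sums are
    matched through isomorphism classes. *)
Lemma sum_irr_embedding (k : fieldType) (A B : fusioncat k) (phi : A -> B)
    (P : B -> Prop) (f : B -> nat) :
  (forall X Y, phi X ≅ phi Y <-> X ≅ Y) -> (forall X, simple X -> simple (phi X)) ->
  (forall X Y, X ≅ Y -> f X = f Y) ->
  (forall Y, simple Y -> P Y <-> exists2 X, simple X & phi X ≅ Y) ->
  (\sum_i f (phi (irr (C := A) i)) = \sum_(j | `[< P (irr (C := B) j) >]) f (irr j))%N.
Proof.
move=> phi_iso phi_s f_iso PP.
have /fin_all_exists[h hE] i := simple_irr (phi_s _ (irr_simple (C := A) i)).
have h_inj : injective h.
  move=> i j hij; case: (irrP A) => _ inj _; apply: inj; apply/phi_iso.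
  by apply: isomorphic_trans (hE i) _; rewrite hij; apply: isomorphic_sym.
transitivity (\sum_(j in h @: [set: irr_idx A]) f (irr j))%N; last first.
  apply: eq_bigl => j; apply/imsetP/asboolP => [[i _ ->]|].
    by apply/(PP _ (irr_simple _)); exists (irr i) => //; exact: irr_simple.
  move=> /(PP _ (irr_simple _))[X sX Xj]; have [i Xi] := simple_irr sX.
  exists i => //; case: (irrP B) => _ inj _; apply: inj.
  apply: isomorphic_trans (isomorphic_sym Xj) (isomorphic_trans _ (hE i)).
  exact/phi_iso.
rewrite big_imset => [|i j _ _]; last exact: h_inj.
by apply: eq_big => [i|i _]; [rewrite inE | exact: f_iso].
Qed.

(** * Normality and dimensions for a composite *)

Section NormalComposite.
Variables (k : fieldType) (C D E : fusioncat k).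
Variables (F'' : tfunctor E D) (F' : tfunctor D C).
Local Notation F := (tf_comp F' F'').
Hypotheses (hnormal : normal F) (hdominant : dominant F'').

(** A simple Y is a factor of some F''X, so F'Y is a retract of F X; if F'Y contains [𝟙], then F X
    does too and is trivial. *)
Lemma normal_composite_right : normal F'.
Proof.
move=> Y sY FY1; have [X [sX XY]] := hdominant sY.
have FX : factor (F' Y) (F X) := factor_tfunctor F' XY.
have [f [r rf]] := factor_retract FX.
apply: (trivial_retract (fus_semisimple (fusP C)) (fus_unit (fusP C)) rf).
exact: hnormal sX (factor_unit_trans FY1 FX).
Qed.

Lemma in_ker_composite (X : E) : in_ker F X -> in_ker F' (F'' X).
Proof. by []. Qed.

Lemma in_ker_right (X : E) : in_ker F'' X -> in_ker F X.
Proof.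
case=> n /(fmor_dirsum F') dX; exists n; apply: dirsum_isoY dX => _.
exact/isomorphic_sym/tfunctor_unit.
Qed.

Local Notation F''0 := (ker_restrict in_ker_composite).

(** A simple Y in Ker F' has [𝟙] in F'Y, so normality of F puts the simple X covering Y into Ker
    F. *)
Lemma ker_restrict_dominant : dominant F''0.
Proof.
move=> Y sY; have [X [sX XY]] := hdominant ((ker_simple Y).1 sY).
have FX : factor (F' (ker_ob Y)) (F X) := factor_tfunctor F' XY.
have tX := hnormal sX (factor_unit_trans (ker_unit_factor sY) FX).
exists (exist _ X tX); split; first exact/ker_simple.
exact: ker_factor.
Qed.

(** For the converse, [𝟙] in F''X gives [𝟙] in F X, so by normality of F every simple X to be tested
    already lies in Ker F. *)
Lemma normal_restrict : normal F'' <-> normal F''0.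
Proof.
split=> [nF X sX|nF X sX X1].
  move=> /factor_retract[f [r rf]].
  apply: (nF (ker_ob X)); first exact/ker_simple.
  exact: (retract_factor (fus_semisimple (fusP D)).1 rf).
have F1 : factor 𝟙 (F X).
  have [f [r rf]] := factor_retract (factor_tfunctor F' X1).
  apply: (retract_factor (fus_semisimple (fusP C)).1
    (f := fmor F' (fmor F'' (idm X)) ∘ f ∘ eps F') (r := epsI F' ∘ r)).
  rewrite !fmor1 comp1m -compA (compA r) rf comp1m.
  exact: epsK.
have tX := hnormal sX F1.
apply: (nF (exist _ X tX)); first exact/ker_simple.
exact: ker_factor.
Qed.

(** Ker F'' sits in Ker F as the kernel of the restricted functor, and F' preserves the number of
    copies of [𝟙] in a trivial object. *)
Lemma FPdim_ker_right (R : realType) : FPdim R (Ker F'') =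
  (\sum_(j : irr_idx (Ker F) | `[< in_ker F''0 (irr j) >])
     hdim 𝟙 (F (ker_ob (irr j))) ^ 2)%:R.
Proof.
rewrite (FPdimE R (ker_dimension F'')); congr (_%:R).
pose phi (X : Ker F'') : Ker F := exist _ (ker_ob X) (in_ker_right (svalP X)).
rewrite -(@sum_irr_embedding k (Ker F'') (Ker F) phi (in_ker F''0)
  (fun X => hdim 𝟙 (F (ker_ob X)) ^ 2)%N) //.
- apply: eq_bigr => i _; congr (_ ^ 2)%N; have [n dX] := svalP (irr i).
  rewrite (hdim_sumr _ dX) (hdim_sumr _ (fmor_dirsum F' dX)).
  apply: eq_bigr => j _; rewrite -(hdim_isor _ (tfunctor_unit F')).
  by rewrite !hdim_simple //; exact: fus_unit (fusP _).
- by move=> X /ker_simple sX; apply/ker_simple.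
- move=> X Y XY; congr (_ ^ 2)%N.
  by have [ad _ _] := ker_dimension F; exact: (additive_iso ad XY).
- move=> Y sY; split=> [tY|[X sX XY]].
    exists (exist _ (ker_ob Y) tY); first exact/ker_simple/(ker_simple Y).
    exact: (isomorphic_refl Y).
  have XY' : @isomorphic k E (ker_ob X) (ker_ob Y) := XY.
  exact: (trivial_iso (tfunctor_iso F'' XY') (svalP X)).
Qed.

(** By [dominant_sum_squares] the index equals [regmult 𝟙], and [normal_regmult] compares this
    number with the dimension of the kernel. *)
Lemma normal_restrict_FPdim (R : realType) :
  normal F''0 <-> FPdim R (Ker F'') = FPindex R (Ker F) (Ker F').
Proof.
have dd := ker_dimension F'; have ddF := dimension_pullback F''0 dd.
rewrite (normal_regmult F''0 dd) /FPindex (FPdimE R ddF) (FPdimE R dd).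
rewrite (dominant_sum_squares dd ker_restrict_dominant) FPdim_ker_right natrM.
rewrite mulfK; last first.
  rewrite pnatr_eq0 sum_nat_eq0; apply/forallP => H.
  have [i _] := simple_irr (fus_unit (fusP (Ker F'))).
  have := dimension_gt0 dd (irr_simple i).1.
  by have := H i; rewrite /= expn_eq0 andbT lt0n => ->.
by split=> [->//|/eqP]; rewrite eqr_nat => /eqP.
Qed.

End NormalComposite.
Theorem theorem5p1 (k : fieldType) (R : realType) (C D E : fusioncat k)
    (F'' : tfunctor E D) (F' : tfunctor D C) (F : tfunctor E C)
    (hF : F = tf_comp F' F'') (hnormal : normal F) (hdominant : dominant F'') :
  normal F' /\
  (forall (adj : right_adjoint F) (adj'' : right_adjoint F''),
     let A := induced_central_algebra adj in
     let A'' := induced_central_algebra adj'' in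
     is_comm_central_algebra A /\ is_comm_central_algebra A'' /\
     is_central_subalgebra A'' A) /\
  (exists h : forall X : E, in_ker F X -> in_ker F' (F'' X),
     let F''0 : tfunctor (Ker F) (Ker F') := ker_restrict h in
     dominant F''0 /\
     (forall X : E,
        in_ker F'' X <-> exists2 X0 : Ker F, ker_ob X0 = X & in_ker F''0 X0) /\
     (normal F'' <-> normal F''0) /\
     (normal F''0 <-> FPdim R (Ker F'') = FPindex R (Ker F) (Ker F'))).
Proof.
subst F; split; first exact: normal_composite_right hnormal hdominant.
split.
  move=> adj adj'' /=; have rigE := fus_rigid (fusP E).
  split; first exact: induced_comm_central_algebra.
  split; first exact: induced_comm_central_algebra.
  apply: induced_central_subalgebra => // Y f; exact: unit_functional_faithful.
exists (@in_ker_composite k C D E F'' F') => /=.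
split; first exact: ker_restrict_dominant hnormal hdominant.
split.
  move=> X; split=> [tX|[X0 <-] //].
  by exists (exist _ X (in_ker_right F' tX)).
split; first exact: normal_restrict hnormal.
exact: normal_restrict_FPdim hnormal hdominant R.
Qed.
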